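(* Let $h$ be a nonnegative definite form in $\mathcal H$ with associated operator $H$, let $X:\mathbb C^n\to\mathcal H$ be an isometry with $\operatorname{ran}(X)\subset\mathcal Q(h)$, put $P=XX^*$, and let $H'$ be the block diagonal part of $H$ with respect to $\operatorname{ran}(X)$. Let $\mu_1\le\cdots\le\mu_n$ be the eigenvalues of $\Xi=(H^{1/2}X)^*H^{1/2}X\in\mathbb C^{n\times n}$, let $\lambda_1\le\lambda_2\le\cdots$ be the eigenvalues of $H$, and let $q\ge2$ be an integer. Put $\sin\Theta_p:=\sin\Theta_p(H^{1/2}\mathcal X,\mathsf{inv}(H^{1/2})\mathcal X)$ with $\mathcal X=\operatorname{ran}(X)$, assume $\sin\Theta_p<1$, and set $\eta_{\Theta_p}=\frac{\sin\Theta_p}{1-\sin\Theta_p}$ and $$\gamma_c=\min\Big\{\min_{\substack{k=1,\dots,n\\ p=1,\dots,q-1}}\frac{\mu_k-\lambda_p}{\lambda_p+\mu_k},\ \min_{\substack{k=1,\dots,n\\ p=q+n,\dots,\infty}}\frac{\lambda_p-\mu_k}{\lambda_p+\mu_k},\ 1\Big\}.$$ If $\eta_{\Theta_p}<\gamma_c$, then $\operatorname{ran}(P)\subset\operatorname{ran}(H')$ and $$|\lambda_{i+q-1}-\mu_i|\le\mu_i\,\sin\Theta_p,\qquad i=1,\dots,n.$$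
   Context: $\mathcal H$ is a Hilbert space. A nonnegative form $h$ is a closed symmetric form with domain $\mathcal Q(h)$ dense in $\mathcal H$ and $h[u]:=h(u,u)\ge0$. Its associated operator $H$ is the nonnegative selfadjoint operator with $\mathcal D(H^{1/2})=\mathcal Q(h)$ and $h(u,v)=(H^{1/2}u,H^{1/2}v)$. The form is nonnegative definite if $\lambda_e(H)>0$, where $\lambda_e(H)$ is the infimum of the essential spectrum of $H$ ($+\infty$ if it is empty). The discrete eigenvalues of $H$, in ascending order and counted with multiplicity, are denoted $0\le\lambda_1\le\lambda_2\le\cdots<\lambda_e(H)$. The block diagonal part of $h$ is $h'(u,v)=h(Pu,Pv)+h((I-P)u,(I-P)v)$, $u,v\in\mathcal Q(h)$; it is a closed nonnegative form, and $H'$ denotes the nonnegative selfadjoint operator it defines, $h'(u,v)=(H'^{1/2}u,H'^{1/2}v)$. The inverse image is $\mathsf{inv}(H^{1/2})\mathcal X=\{x\in\mathcal D(H^{1/2}):H^{1/2}x\in\mathcal X\}$. For finite dimensional subspaces with orthogonal projections $P_1,P_2$, the maximal principal angle is $\Theta_p=\arcsin\min\{\|P_1(I-P_2)\|,\|P_2(I-P_1)\|\}$.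
   Formalization: If H has only finitely many discrete eigenvalues, the sequence λ_p is continued by λ_e(H) in the definition of γ_c (the ratio being 1 when λ_e(H)=+∞), without which the claim can fail; the conclusion then also asserts λ_{i+q-1}<λ_e(H). *)

(* Defs.v *)
From HB Require Import structures.
From mathcomp Require Import all_boot all_order all_algebra.
From mathcomp Require Import all_classical all_reals all_analysis.
From mathcomp Require Import complex sesquilinear spectral.

Set Implicit Arguments.
Unset Strict Implicit.
Unset Printing Implicit Defensive.

Import Order.TTheory GRing.Theory Num.Theory.
Import numFieldNormedType.Exports.

Local Open Scope classical_set_scope.
Local Open Scope ring_scope.

(* The inner product is linear in its first argument. *)
Record hilbertSpace (R : realType) := HilbertSpace {
  hcarrier :> completeNormedModType R[i];
  inner : {dot hcarrier for Num.conj};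
  innerE : forall x : hcarrier, `|x| ^+ 2 = inner x x }.

Section Subspaces.
Context {R : realType} {E : hilbertSpace R}.
Implicit Types (W : set E) (B : E -> E) (x y : E).

Definition subspace W :=
  W 0 /\ forall (a : R[i]) x y, W x -> W y -> W (a *: x + y).

Definition has_dim W (m : nat) :=
  exists f : {linear 'rV[R[i]]_m -> E}, injective f /\ range f = W.

(* The value is meaningful only when the projection exists, for instance when
   W is a finite dimensional subspace. *)
Definition orthoproj W x : E :=
  xget 0 [set y | W y /\ forall w, W w -> inner E (x - y) w = 0].

(* Norms are elements of R[i]; complex.Re brings them back to R. *)
Definition opnorm B : R :=
  sup [set complex.Re `|B x| | x in [set x | `|x| <= 1]].

Definition principal_angle W1 W2 : R :=
  let P1 := orthoproj W1 in let P2 := orthoproj W2 in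
  asin (Num.min (opnorm (fun x => P1 (x - P2 x)))
                (opnorm (fun x => P2 (x - P1 x)))).

End Subspaces.

Section Operators.
Context {R : realType} {E : hilbertSpace R}.

(* Possibly unbounded operator; the values off opdom are irrelevant. *)
Record operator := Operator { opdom : set E; opfun :> E -> E }.

Implicit Types (S T : operator) (W : set E).

Definition linear_operator T := subspace (opdom T) /\
  forall (a : R[i]) x y, opdom T x -> opdom T y -> T (a *: x + y) = a *: T x + T y.

(* The last clause is T^* = T, including equality of the domains. *)
Definition selfadjoint T := [/\ linear_operator T, dense (opdom T) &
  forall y z, (forall x, opdom T x -> inner E (T x) y = inner E x z) <->
              (opdom T y /\ T y = z)].

Definition nonneg_operator T := forall x, opdom T x -> 0 <= inner E (T x) x.

(* S = T^{1/2} *)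
Definition is_sqrt S T := [/\ selfadjoint S, nonneg_operator S &
  opdom T = [set x | opdom S x /\ opdom S (S x)] /\
  forall x, opdom T x -> T x = S (S x)].

Definition oprange T : set E := T @` opdom T.

Definition opinv T W : set E := [set x | opdom T x /\ W (T x)].

Definition eigenspace T (z : R[i]) : set E :=
  [set x | opdom T x /\ T x = z *: x].

Definition resolvent_set T : set R[i] := [set z |
  exists B : E -> E,
    [/\ forall y, opdom T (B y) /\ T (B y) - z *: B y = y,
        forall x, opdom T x -> B (T x - z *: x) = x &
        exists M : R[i], forall y, `|B y| <= M * `|y| ]].

Definition spectrum T : set R[i] := ~` resolvent_set T.

(* The isolated points of the spectrum which are eigenvalues of finite
   multiplicity. *)
Definition discrete_spectrum T : set R[i] := [set z | [/\ spectrum T z,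
  exists e : R, 0 < e /\ forall w, spectrum T w -> `|w - z| < e%:C%C -> w = z &
  exists m : nat, (0 < m)%N /\ has_dim (eigenspace T z) m]].

Definition essential_spectrum T : set R[i] :=
  spectrum T `\` discrete_spectrum T.

Definition lambda_e T : \bar R :=
  ereal_inf [set t%:E | t in [set t : R | essential_spectrum T t%:C%C]].

(* lam 1 <= lam 2 <= ... lists the eigenvalues of T below lambda_e T, each
   repeated according to its multiplicity (lam 0 is not used).  If there are
   only finitely many of them, the remaining terms are set to lambda_e T, as in
   the min-max principle. *)
Definition discrete_eigenvalues T (lam : nat -> \bar R) :=
  [/\ forall p r, (0 < p <= r)%N -> (lam p <= lam r)%E,
      forall p, (0 < p)%N -> (-oo < lam p <= lambda_e T)%E &
      forall t : R, (t%:E < lambda_e T)%E -> exists m : nat,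
        has_dim (eigenspace T t%:C%C) m /\
        ([set p | (0 < p)%N /\ lam p = t%:E] #= `I_m)%card].

End Operators.
Arguments operator {R} E.

Section Forms.
Context {R : realType} {E : hilbertSpace R}.

(* The values off fdom are irrelevant. *)
Record hilbert_form := HilbertForm { fdom : set E; fval :> E -> E -> R[i] }.

Implicit Types (h : hilbert_form) (H S : operator E).

(* h[u], which is real for a symmetric form *)
Definition qform h (u : E) : R := complex.Re (h u u).

Definition symmetric_form h := subspace (fdom h) /\
  (forall (a : R[i]) u v w, fdom h u -> fdom h v -> fdom h w ->
     h (a *: u + v) w = a * h u w + h v w) /\
  (forall u v, fdom h u -> fdom h v -> h v u = (h u v)^*).

Definition closed_form h := forall (u : nat -> E) (x : E),
  (forall k, fdom h (u k)) -> u @ \oo --> x ->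
  (forall e : R, 0 < e -> exists N : nat, forall k l : nat,
     (N <= k)%N -> (N <= l)%N -> qform h (u k - u l) < e) ->
  fdom h x /\ (fun k => qform h (u k - x)) @ \oo --> (0 : R).

Definition nonneg_form h := [/\ symmetric_form h, closed_form h,
  dense (fdom h) & forall u, fdom h u -> 0 <= h u u].

(* H is the nonnegative selfadjoint operator defined by h, and S = H^{1/2}. *)
Definition associated_operator h H S := [/\ selfadjoint H, nonneg_operator H,
  is_sqrt S H, opdom S = fdom h &
  forall u v, fdom h u -> fdom h v -> h u v = inner E (S u) (S v)].

Definition block_diagonal h (P : E -> E) : hilbert_form := {|
  fdom := fdom h;
  fval := fun u v => h (P u) (P v) + h (u - P u) (v - P v) |}.

End Forms.
Arguments hilbert_form {R} E.

Section Matrices.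
Context {R : realType} {E : hilbertSpace R} {n : nat}.
Implicit Types T : 'rV[R[i]]_n -> E.

(* T^* for a linear map T, C^n being the row vectors with dotmx as inner
   product; see adjE. *)
Definition adj T (y : E) : 'rV[R[i]]_n := \row_i inner E y (T (delta_mx 0 i)).

Lemma adjE (T : {linear 'rV[R[i]]_n -> E}) (y : E) (a : 'rV[R[i]]_n) :
  dotmx (adj T y) a = inner E y (T a).
Proof.
rewrite dotmxE mxE [in RHS](row_sum_delta a) !linear_sum /=.
by apply: eq_bigr => j _; rewrite !mxE !linearZ /= mulrC.
Qed.

(* The matrix of T^* T in the canonical basis *)
Definition gram T : 'M[R[i]]_n :=
  \matrix_(i, j) adj T (T (delta_mx 0 j)) 0 i.

(* mu lists the eigenvalues of A in ascending order with multiplicity. *)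
Definition eigenvalues_of (A : 'M[R[i]]_n) (mu : 'I_n -> R) :=
  (forall i j : 'I_n, (i <= j)%N -> mu i <= mu j) /\
  char_poly A = \prod_i ('X - ((mu i)%:C%C)%:P).

End Matrices.

Section Gap.
Context {R : realType} {n : nat}.

(* (l - m) / (l + m), with its limit value for infinite l *)
Definition rel_gap (l : \bar R) (m : R) : R :=
  match l with
  | r%:E => (r - m) / (r + m)
  | +oo%E => 1
  | -oo%E => -1
  end.

Definition gamma_c (lam : nat -> \bar R) (mu : 'I_n -> R) (q : nat) : \bar R :=
  Order.min
    (ereal_inf [set x | exists (k : 'I_n) (p : nat),
       (1 <= p <= q - 1)%N /\ x = (- rel_gap (lam p) (mu k))%:E])
    (Order.min
      (ereal_inf [set x | exists (k : 'I_n) (p : nat),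
         (q + n <= p)%N /\ x = (rel_gap (lam p) (mu k))%:E])
      1%E).

End Gap.

(* Main.v *)
(** For [u] in the range of [X] and [v] orthogonal to it, [H^(1/2) v] is
orthogonal to [inv(H^(1/2)) ran X], so the off-diagonal part of [h] is bounded
by [sin Theta_p] relative to the block diagonal part [h']: [(1 - s) h' <= h <=
(1 + s) h'] with [s = sin Theta_p]. The spectrum of [H'] is not needed.

Number [lam] from 1 and [mu] from 0. If [lam_m < (1 - s) mu_j], the span of the
first [m] eigenvectors of [H] contains [m - j] directions orthogonal to the
first [j] Ritz vectors; projected off [ran X] they keep [h' <= mu_j], and
together with the first [r + 1] Ritz vectors they form a trial space showing
[lam_(m - j + r + 1) <= (1 + s) mu_r]. With [m = q - 1], [j = 0] this is the
upper bound on [lam_(i + q)]; were the lower bound to fail, [m = i + q], [j =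
i] and [r = n - 1] would give [lam_(q + n) <= (1 + s) mu_(n - 1)], against the
gap hypothesis.

The min-max inequality behind this is proved without the spectral theorem, by
raising a lower bound [t] of [H] on the complement of finitely many
eigenvectors: [t] can be increased while it is in the resolvent set, and also
at an isolated point of the spectrum, where the bounded operator [D = (1 +
t)^-1 - (H + 1)^-1] is nonnegative and has a gap [(0, rho)], hence [D >= rho]
as soon as its kernel is trivial. *)
Require Import Defs.
From HB Require Import structures.
From mathcomp Require Import all_boot all_order all_algebra.
From mathcomp Require Import all_classical all_reals all_analysis.
From mathcomp Require Import perm complex sesquilinear spectral.
From mathcomp Require Import ring lra.

Set Implicit Arguments.
Unset Strict Implicit.
Unset Printing Implicit Defensive.

Import Order.TTheory GRing.Theory Num.Theory.
Import numFieldNormedType.Exports.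

Local Open Scope classical_set_scope.
Local Open Scope ring_scope.

(* mathcomp-analysis and mxalgebra have homonymous notions. *)
Local Notation subspace := Defs.subspace.
Local Notation eigenspace := Defs.eigenspace.

(** * The real inner product *)

Section RealInnerProduct.
Context {R : realType} {E : hilbertSpace R}.
Implicit Types (x y z : E) (r : R) (a : R[i]).

(** The inner product takes values in [R[i]]; its real part makes [E] a real inner product space, so
    that inequalities between quadratic forms live in [R]. *)
Definition ip x y : R := complex.Re (inner E x y).
Definition nsq x : R := ip x x.

Lemma innerDl x y z : inner E (x + y) z = inner E x z + inner E y z.
Proof. exact: linearDl. Qed.

Lemma innerDr x y z : inner E z (x + y) = inner E z x + inner E z y.
Proof. exact: linearDr. Qed.

Lemma innerZl a x z : inner E (a *: x) z = a * inner E x z.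
Proof. exact: linearZl_LR. Qed.

Lemma innerZr a x z : inner E z (a *: x) = a^*%R * inner E z x.
Proof. exact: linearZr_LR. Qed.

Lemma inner0l z : inner E 0 z = 0. Proof. exact: linear0l. Qed.
Lemma inner0r z : inner E z 0 = 0. Proof. exact: linear0r. Qed.
Lemma innerNl x z : inner E (- x) z = - inner E x z. Proof. exact: linearNl. Qed.
Lemma innerNr x z : inner E z (- x) = - inner E z x. Proof. exact: linearNr. Qed.

Lemma innerBl x y z : inner E (x - y) z = inner E x z - inner E y z.
Proof. by rewrite innerDl innerNl. Qed.

Lemma inner_suml (I : Type) (s : seq I) (P : pred I) (F : I -> E) z :
  inner E (\sum_(i <- s | P i) F i) z = \sum_(i <- s | P i) inner E (F i) z.
Proof. exact: linear_sumlz. Qed.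

Lemma inner_sumr (I : Type) (s : seq I) (P : pred I) (F : I -> E) z :
  inner E z (\sum_(i <- s | P i) F i) = \sum_(i <- s | P i) inner E z (F i).
Proof. exact: linear_sumr. Qed.

Lemma innerC x y : inner E y x = (inner E x y)^*%R.
Proof. by have := hermC (inner E) y x; rewrite /= expr0 mul1r. Qed.

Lemma inner_eq0C x y : inner E x y = 0 -> inner E y x = 0.
Proof. by move=> xy0; rewrite innerC xy0 conjC0. Qed.

Lemma innerxx x : inner E x x = (nsq x)%:C%C.
Proof.
by rewrite /nsq /ip RRe_real // ger0_real // dnorm_ge0.
Qed.

Lemma ipE x y : inner E x y = 0 -> ip x y = 0.
Proof. by rewrite /ip => ->. Qed.

Lemma ipC x y : ip x y = ip y x.
Proof. by rewrite /ip innerC; case: (inner E y x). Qed.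

Lemma ipDl x y z : ip (x + y) z = ip x z + ip y z.
Proof. by rewrite /ip innerDl; case: (inner E x z) (inner E y z) => ? ? []. Qed.

Lemma ipZl r x z : ip (r%:C%C *: x) z = r * ip x z.
Proof. by rewrite /ip innerZl; case: (inner E x z) => u v /=; rewrite mul0r subr0. Qed.

Lemma ipNl x z : ip (- x) z = - ip x z.
Proof. by rewrite /ip innerNl; case: (inner E x z). Qed.

Lemma ipDr x y z : ip z (x + y) = ip z x + ip z y.
Proof. by rewrite ipC ipDl !(ipC z). Qed.

Lemma ipZr r x z : ip z (r%:C%C *: x) = r * ip z x.
Proof. by rewrite ipC ipZl (ipC z). Qed.

Lemma ipNr x z : ip z (- x) = - ip z x.
Proof. by rewrite ipC ipNl (ipC z). Qed.

Lemma ip0l z : ip 0 z = 0. Proof. exact/ipE/inner0l. Qed.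
Lemma ip0r z : ip z 0 = 0. Proof. exact/ipE/inner0r. Qed.

Definition ip_simp := (ipDl, ipDr, ipZl, ipZr, ipNl, ipNr, ip0l, ip0r).

Lemma nsq_ge0 x : 0 <= nsq x.
Proof. by rewrite -ler0c -innerxx dnorm_ge0. Qed.

Lemma nsq_eq0 x : (nsq x == 0) = (x == 0).
Proof. by rewrite -(dnorm_eq0 (inner E)) innerxx (fmorph_eq0 (real_complex R)). Qed.

Lemma nsq0 : nsq 0 = 0. Proof. exact: ip0l. Qed.

Lemma nsq_gt0 x : (0 < nsq x) = (x != 0).
Proof. by rewrite lt_def nsq_eq0 nsq_ge0 andbT. Qed.

Lemma nsqZ r x : nsq (r%:C%C *: x) = r ^+ 2 * nsq x.
Proof. by rewrite /nsq !ip_simp mulrA expr2. Qed.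

Lemma nsqN x : nsq (- x) = nsq x.
Proof. by rewrite /nsq !ip_simp opprK. Qed.

Lemma nsqD x y : nsq (x + y) = nsq x + nsq y + 2 * ip x y.
Proof. by rewrite /nsq !ip_simp (ipC y x); ring. Qed.

Lemma nsqD_orth x y : inner E x y = 0 -> nsq (x + y) = nsq x + nsq y.
Proof. by move=> /ipE xy0; rewrite nsqD xy0 mulr0 addr0. Qed.

Lemma nsqD_le x y : nsq (x + y) <= 2 * nsq x + 2 * nsq y.
Proof.
have := nsq_ge0 (x - y); rewrite !nsqD nsqN ip_simp; lra.
Qed.

Lemma nsq_norm x : (nsq x)%:C%C = `|x| ^+ 2.
Proof. by rewrite innerE innerxx. Qed.

Lemma young r x y : 0 < r -> 2 * ip x y <= r * nsq x + nsq y / r.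
Proof.
move=> r0; have := nsq_ge0 (r%:C%C *: x - y).
rewrite nsqD nsqN nsqZ !ip_simp => h.
rewrite -(ler_pM2l r0); have -> : r * (r * nsq x + nsq y / r) = r ^+ 2 * nsq x + nsq y.
  by field; rewrite gt_eqF.
by lra.
Qed.

Lemma subspaceD (K : set E) x y : subspace K -> K x -> K y -> K (x + y).
Proof. by move=> [_ h] Kx Ky; have := h 1 _ _ Kx Ky; rewrite scale1r. Qed.

Lemma subspaceZ (K : set E) a x : subspace K -> K x -> K (a *: x).
Proof. by move=> [K0 h] Kx; have := h a _ _ Kx K0; rewrite addr0. Qed.

Lemma subspaceB (K : set E) x y : subspace K -> K x -> K y -> K (x - y).
Proof.
by move=> sK Kx Ky; apply: subspaceD => //; rewrite -scaleN1r; apply: subspaceZ.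
Qed.

Lemma subspace_sum (K : set E) (I : Type) (s : seq I) (P : pred I) (F : I -> E) :
  subspace K -> (forall i, P i -> K (F i)) -> K (\sum_(i <- s | P i) F i).
Proof.
move=> sK KF; elim/big_ind: _ => //; first exact: sK.1.
by move=> x y; apply: subspaceD.
Qed.

End RealInnerProduct.

(** * Symmetric operators with a spectral gap *)

Section SymmetricOperators.
Context {R : realType} {E : hilbertSpace R}.
Variable K : set E.
Hypothesis subK : subspace K.
Implicit Types (x y z : E) (F D : E -> E).

Definition ipsym F := forall x y, ip (F x) y = ip x (F y).

Lemma linearB_of F : linear F -> forall x y, F (x - y) = F x - F y.
Proof.
by move=> lF x y; rewrite addrC -scaleN1r lF scaleN1r addrC.
Qed.

Lemma linear0_of F : linear F -> F 0 = 0.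
Proof. by move=> lF; have := linearB_of lF 0 0; rewrite !subrr. Qed.

Lemma linearZ_of F : linear F -> forall (a : R[i]) x, F (a *: x) = a *: F x.
Proof.
by move=> lF a x; have := lF a x 0; rewrite !addr0 (linear0_of lF) addr0.
Qed.

(* The largest admissible [b] is attained, so it cannot be below [T]. *)
Lemma quadratic_lower_bound (q : E -> R) (T : R) :
  (forall x, K x -> 0 <= q x) ->
  (forall b, 0 <= b < T -> (forall x, K x -> b * nsq x <= q x) ->
     exists2 e, 0 < e & forall x, K x -> (b + e) * nsq x <= q x) ->
  forall x, K x -> T * nsq x <= q x.
Proof.
move=> q0 step x0 Kx0; rewrite leNgt; apply/negP => qx0.
have nx0 : 0 < nsq x0.
  rewrite nsq_gt0; apply/eqP => x00; move: qx0 (q0 _ Kx0).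
  by rewrite x00 nsq0 mulr0 => /lt_le_trans h /h; rewrite ltxx.
pose S := [set b | 0 <= b /\ forall x, K x -> b * nsq x <= q x].
have S0 : S 0 by split => // x Kx; rewrite mul0r q0.
have ubS : ubound S (q x0 / nsq x0).
  by move=> b [_ /(_ _ Kx0)]; rewrite ler_pdivlMr.
have hS : has_sup S by split; [exists 0|exists (q x0 / nsq x0)].
have supS : S (sup S).
  split; first exact: (ub_le_sup hS.2 S0).
  move=> x Kx; have [/eqP|nx] := eqVneq (nsq x) 0.
    by rewrite nsq_eq0 => /eqP ->; rewrite nsq0 mulr0 q0 //; exact: subK.1.
  have {}nx : 0 < nsq x by rewrite lt_def nx nsq_ge0.
  rewrite -ler_pdivlMr //; apply: ge_sup; first by exists 0.
  by move=> b [_ /(_ _ Kx)]; rewrite ler_pdivlMr.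
have ltT : sup S < T.
  apply: (le_lt_trans (ge_sup _ ubS)); first by exists 0.
  by rewrite ltr_pdivrMr.
have [|e e0 he] := step (sup S) _ supS.2; first by rewrite supS.1.
have : S (sup S + e) by split => //; rewrite addr_ge0 ?supS.1 // ltW.
by move=> /(ub_le_sup hS.2); rewrite gerDl leNgt e0.
Qed.

(** Nonnegativity of the form at [x - M^-1 F x], combined with the upper bound at [F x]. This is F^2
    <= M F without a square root of [F]. *)
Lemma nsq_le_form F (M : R) : linear F -> ipsym F ->
  (forall x, K x -> K (F x)) -> 0 < M ->
  (forall x, K x -> 0 <= ip (F x) x <= M * nsq x) ->
  forall x, K x -> nsq (F x) <= M * ip (F x) x.
Proof.
move=> lF sF KF M0 bF x Kx.
have KFx := KF _ Kx; have /andP[_ hM] := bF _ KFx.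
have /andP[+ _] := bF _ (subK.2 (- M^-1)%:C%C _ _ KFx Kx).
rewrite lF !ip_simp (sF (F x) x) -/(nsq (F x)) => h.
have : 0 <= M^-1 ^+ 2 * (M * nsq (F x)) - 2 * M^-1 * nsq (F x) + ip (F x) x.
  apply: le_trans h _.
  have : M^-1 ^+ 2 * ip (F (F x)) (F x) <= M^-1 ^+ 2 * (M * nsq (F x)).
    by rewrite ler_wpM2l // sqr_ge0.
  lra.
have -> : M^-1 ^+ 2 * (M * nsq (F x)) = M^-1 * nsq (F x).
  by field; rewrite gt_eqF.
move=> h2; rewrite -(ler_pM2l (_ : 0 < M^-1)) ?invr_gt0 // mulKf ?gt_eqF //; lra.
Qed.

End SymmetricOperators.

(** * Lower bound of a nonnegative operator from a gap above zero *)

Section SpectralGap.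
Context {R : realType} {E : hilbertSpace R}.
Variable K : set E.
Hypothesis subK : subspace K.
Variables (D : E -> E) (M rho : R).
Hypothesis linD : linear D.
Hypothesis symD : ipsym D.
Hypothesis KD : forall x, K x -> K (D x).
Hypothesis M0 : 0 < M.
Hypothesis boundD : forall x, K x -> 0 <= ip (D x) x <= M * nsq x.
Hypothesis rho0 : 0 < rho.
Hypothesis gapD : forall t, 0 < t < rho -> exists2 c, 0 < c &
  forall x, K x -> c * nsq x <= nsq (D x - t%:C%C *: x).

Let shift (t : R) x := D x - t%:C%C *: x.

Let shiftK t x : K x -> K (shift t x).
Proof. by move=> Kx; apply: subspaceB => //; [exact: KD|exact: subspaceZ]. Qed.

Let linear_shift t : linear (shift t).
Proof.
move=> a x y; rewrite /shift linD scalerDr !scalerBr opprD addrACA; congr (_ + _).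
by congr (_ - _); rewrite !scalerA mulrC.
Qed.

Let ip_shift t x y : ip (shift t x) y = ip x (shift t y).
Proof. by rewrite /shift !ip_simp symD. Qed.

Let shiftC t1 t2 x : shift t1 (shift t2 x) = shift t2 (shift t1 x).
Proof.
rewrite /shift !(linearB_of linD) !(linearZ_of linD) !scalerBr !scalerA.
rewrite (mulrC t2%:C%C) -!addrA; congr (_ + _).
by rewrite -!opprD addrCA.
Qed.

Let nsqD_bound x : K x -> nsq (D x) <= M ^+ 2 * nsq x.
Proof.
move=> Kx; have /andP[_ h] := boundD Kx.
have := nsq_le_form subK linD symD KD M0 boundD Kx.
have : M * ip (D x) x <= M * (M * nsq x) by rewrite ler_pM2l.
rewrite expr2; lra.
Qed.

Let nsq_shift t x : nsq (shift t x) = nsq (D x) - 2 * t * ip (D x) x + t ^+ 2 * nsq x.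
Proof. by rewrite /shift nsqD nsqN nsqZ !ip_simp; ring. Qed.

(** This is D (D - rho) >= 0. Completing the square at the midpoint m = rho / 2 turns it into (D -
    m)^2 >= m^2, and any bound b = w^2 < m^2 can be raised. *)
Lemma resolvent_gap x : K x -> rho * ip (D x) x <= nsq (D x).
Proof.
pose m := rho / 2; have m0 : 0 < m by rewrite divr_gt0.
suff h : forall x, K x -> m ^+ 2 * nsq x <= nsq (shift m x).
  by move/h; rewrite nsq_shift /m; lra.
apply: (quadratic_lower_bound subK) => [y _|b /andP[b0 bm] hb]; first exact: nsq_ge0.
have [w w0 w2] : exists2 w : R, 0 <= w & w ^+ 2 = b.
  by exists (Num.sqrt b); rewrite ?sqrtr_ge0 ?sqr_sqrtr.
have wm : w < m by rewrite -(ltr_pXn2r (n := 2)) ?nnegrE ?w2 // ltW.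
have [|c1 c10 h1] := gapD (t := m - w).
  by rewrite subr_gt0 wm /= /m; move: w0 rho0; lra.
have [|c2 c20 h2] := gapD (t := m + w).
  by apply/andP; split; [move: w0 m0; lra|move: wm; rewrite /m; lra].
(* [F] is (D - m)^2 - w^2 in factored form; m - w and m + w both lie in the gap, so each factor is
   bounded below, and [nsq_le_form] turns this into a bound on the form of [F]. *)
pose F y := shift (m - w) (shift (m + w) y).
have FE y : ip (F y) y = nsq (shift m y) - b * nsq y.
  rewrite ip_shift nsq_shift /shift !ip_simp !(ipC y) -/(nsq y) -/(nsq (D y)) -w2.
  by ring.
have M'0 : 0 < 2 * M ^+ 2 + 2 * m ^+ 2.
  by rewrite addr_gt0 // mulr_gt0 // exprn_gt0.
have bF y : K y -> 0 <= ip (F y) y <= (2 * M ^+ 2 + 2 * m ^+ 2) * nsq y.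
  move=> Ky; rewrite FE subr_ge0 hb //=.
  have : nsq (shift m y) <= 2 * nsq (D y) + 2 * (m ^+ 2 * nsq y).
    by apply: le_trans (nsqD_le _ _) _; rewrite nsqN nsqZ.
  have := nsqD_bound Ky; have := mulr_ge0 b0 (nsq_ge0 y); lra.
have KF y : K y -> K (F y) by move=> Ky; do 2!apply: shiftK.
have lF : linear F by move=> a y z; rewrite /F !linear_shift.
have sF : ipsym F by move=> y z; rewrite /F ip_shift ip_shift shiftC.
have hF := nsq_le_form subK lF sF KF M'0 bF.
exists (c1 * c2 / (2 * M ^+ 2 + 2 * m ^+ 2)); first by rewrite divr_gt0 // mulr_gt0.
move=> y Ky; rewrite mulrDl -lerBrDl -FE mulrAC ler_pdivrMr // [leRHS]mulrC -mulrA.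
apply: le_trans (le_trans (h1 _ (shiftK _ Ky)) (hF _ Ky)).
by rewrite ler_pM2l // h2.
Qed.

(* The Cauchy-Schwarz inequality for the form of [D], in the variables
   [x] and [D x] *)
Lemma gap_on_range x : K x -> rho * nsq (D x) <= ip (D (D x)) (D x).
Proof.
move=> Kx; have h := resolvent_gap Kx.
have /andP[+ _] := boundD (subK.2 (- rho^-1)%:C%C _ _ (KD Kx) Kx).
rewrite linD !ip_simp (symD (D x) x) -/(nsq (D x)) => h2.
have h3 : ip (D x) x <= rho^-1 * nsq (D x).
  by rewrite -(ler_pM2l rho0) mulVKf ?gt_eqF.
have h4 : rho^-1 * nsq (D x) <= rho^-1 ^+ 2 * ip (D (D x)) (D x) by lra.
move: h4; rewrite expr2 -mulrA ler_pM2l ?invr_gt0 //.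
by rewrite -(ler_pM2l rho0) mulVKf ?gt_eqF.
Qed.

Hypothesis closedK : forall (u : nat -> E) x, (forall k, K (u k)) ->
  (fun k => nsq (u k - x)) @ \oo --> (0 : R) -> K x.
Hypothesis injD : forall x, K x -> D x = 0 -> x = 0.

(** Completeness of [E] in terms of [nsq]. Radii are positive elements of [R[i]], that is positive
    reals, so each is replaced by its real part. *)
Lemma nsq_complete (u : nat -> E) (b : R ^nat) : b @ \oo --> (0 : R) ->
  (forall i j, (i <= j)%N -> nsq (u i - u j) <= b i) ->
  exists x, (fun k => nsq (u k - x)) @ \oo --> (0 : R).
Proof.
move=> b0 ub.
have : cvg (u @ \oo).
  apply/cauchy_cvgP/cauchy_exP => e; rewrite ltcE /= => /andP[/eqP e_im e_re].
  have ee : e = (complex.Re e)%:C%C by case: e e_im e_re => a c /= -> _.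
  pose r := complex.Re e; rewrite -/r in e_re.
  have [N _ bN] : \forall k \near \oo, b k < r ^+ 2.
    by apply: (cvgr_lt 0) => //; rewrite exprn_gt0.
  exists (u N); exists N => // k /= Nk; rewrite -ball_normE /ball_ /= ee -/r.
  rewrite -(ltr_pXn2r (n := 2)) ?nnegrE ?lecR ?ler0c ?(ltW e_re) //.
  rewrite -nsq_norm -rmorphXn ltcR; apply: le_lt_trans (ub _ _ Nk) _.
  exact: (bN N (leqnn N)).
move=> /cvg_ex[x ux]; exists x.
apply/cvgrPdist_lt => e e0.
have e0' : 0 < (Num.sqrt e)%:C%C :> R[i] by rewrite ltcR sqrtr_gt0.
have /cvgrPdist_lt /(_ _ e0') uxe := ux; apply: filterS uxe => k uxe.
rewrite sub0r normrN ger0_norm ?nsq_ge0 // -ltcR nsq_norm.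
have -> : e = Num.sqrt e ^+ 2 by rewrite sqr_sqrtr // ltW.
rewrite rmorphXn ltr_pXn2r ?nnegrE ?ler0c ?sqrtr_ge0 //.
by rewrite distrC.
Qed.

Hypothesis rhoM : rho <= M.

(** D >= rho holds on the range of [D], and the iterates u_k = (1 - D / M)^k x differ from [x] by
    elements of that range. They converge to an element of the kernel, which is 0; so [x] is a limit
    of elements of the range and the bound passes to it. *)
Lemma gap_lower_bound x : K x -> rho * nsq x <= ip (D x) x.
Proof.
move=> Kx; pose step z := z - (M^-1)%:C%C *: D z.
have Kstep z : K z -> K (step z).
  by move=> Kz; apply: subspaceB => //; apply: subspaceZ => //; apply: KD.
pose u k := iter k step x.
have Ku k : K (u k) by elim: k => //= k; apply: Kstep.
have ranu k : exists2 z, K z & u k - x = D z.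
  elim: k => [|k [z Kz hz]].
    by exists 0; rewrite ?subrr ?(linear0_of linD) //; exact: subK.1.
  exists (z - (M^-1)%:C%C *: u k).
    by apply: subspaceB => //; exact: subspaceZ.
  by rewrite /= -/(u k) /step addrAC hz (linearB_of linD) (linearZ_of linD).
have range_inv z : K z -> rho ^+ 2 * nsq (D z) <= nsq (D (D z)).
  move=> Kz; have := resolvent_gap (KD Kz).
  by apply: le_trans; rewrite expr2 -mulrA ler_pM2l // gap_on_range.
(* Since M^-2 |D D u|^2 <= M^-1 (D D u, D u), one step lowers |D u|^2 by at least (rho / M) |D
   u|^2. *)
pose th := 1 - rho / M.
have th01 : 0 <= th < 1.
  by rewrite subr_ge0 ler_pdivrMr // mul1r rhoM /= gtrBl divr_gt0.
have decay k : nsq (D (u k)) <= th ^+ k * nsq (D x).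
  elim: k => [|k IH]; first by rewrite mul1r.
  rewrite exprS -mulrA; apply: le_trans (_ : th * nsq (D (u k)) <= _); last first.
    by rewrite ler_wpM2l //; case/andP: th01.
  rewrite /= -/(u k) /step (linearB_of linD) (linearZ_of linD).
  have h1 := gap_on_range (Ku k).
  have h2 := nsq_le_form subK linD symD KD M0 boundD (KD (Ku k)).
  rewrite nsqD nsqN nsqZ !ip_simp (ipC (D (u k))) /th.
  set A := ip _ _ in h1 h2 *; set B := nsq (D (D _)) in h2 *.
  have h3 : M^-1 ^+ 2 * B <= M^-1 * A.
    by rewrite expr2 -mulrA ler_pM2l ?invr_gt0 // mulrC ler_pdivrMr // mulrC.
  have h4 : M^-1 * (rho * nsq (D (u k))) <= M^-1 * A by rewrite ler_pM2l ?invr_gt0.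
  lra.
have th_le i j : (i <= j)%N -> th ^+ j <= th ^+ i.
  by move=> ij; case/andP: th01 => ? ?; rewrite ler_wiXn2l // ltW.
pose C := 4 * nsq (D x) / rho ^+ 2.
have cvg_th c : (fun k => c * th ^+ k) @ \oo --> (0 : R).
  rewrite -[X in _ --> X](mulr0 c); apply: cvgMl_tmp; apply: cvg_expr.
  by case/andP: th01 => ? ?; rewrite ger0_norm.
have [l ul] : exists l, (fun k => nsq (u k - l)) @ \oo --> (0 : R).
  apply: nsq_complete (cvg_th C) _ => i j ij.
  have [[zi Ki hi] [zj Kj hj]] := (ranu i, ranu j).
  have -> : u i - u j = D (zi - zj).
    by rewrite (linearB_of linD) -hi -hj opprB addrA subrK.
  rewrite -(ler_pM2l (_ : 0 < rho ^+ 2)) ?exprn_gt0 //.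
  apply: le_trans (range_inv _ (subspaceB subK Ki Kj)) _.
  rewrite (linearB_of linD) -hi -hj opprB addrA subrK (linearB_of linD).
  have -> : rho ^+ 2 * (C * th ^+ i) = 4 * (th ^+ i * nsq (D x)).
    by rewrite /C; field; rewrite gt_eqF.
  have := nsqD_le (D (u i)) (- D (u j)); rewrite nsqN.
  have := decay i; have := decay j.
  have := ler_wpM2r (nsq_ge0 (D x)) (th_le _ _ ij); lra.
have Kl : K l by exact: closedK ul.
have l0 : l = 0.
  apply: injD => //; apply/eqP; rewrite -nsq_eq0 eq_le nsq_ge0 andbT.
  have cv : (fun k => 2 * M ^+ 2 * nsq (u k - l) + 2 * nsq (D x) * th ^+ k) @ \oo
      --> (0 : R).
    rewrite -[X in _ --> X]addr0; apply: cvgD; last exact: cvg_th.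
    by rewrite -[X in _ --> X](mulr0 (2 * M ^+ 2)); apply: cvgMl_tmp.
  apply: ler_cvg_to (cvg_cst (nsq (D l))) cv _; apply: nearW => k.
  have := nsqD_le (D (u k)) (- D (u k - l)).
  rewrite nsqN -(linearB_of linD) opprB addrC subrK.
  have := nsqD_bound (subspaceB subK (Ku k) Kl); have := decay k; lra.
have {}ul : (fun k => nsq (u k)) @ \oo --> (0 : R).
  by move: ul; rewrite l0; under eq_fun do rewrite subr0.
pose v := rho%:C%C *: x - D x.
(* The inequality D >= rho at [u k - x], expanded; what remains of [u k] is a cross term against the
   fixed vector [v] and a quadratic error. *)
have hk k : rho * nsq x - ip (D x) x <= 2 * ip v (u k) + M * nsq (u k).
  have [z Kz hz] := ranu k; have := gap_on_range Kz; rewrite -hz.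
  have /andP[_ hM] := boundD (Ku k); have := mulr_ge0 (ltW rho0) (nsq_ge0 (u k)).
  rewrite (linearB_of linD) nsqD nsqN /v !ip_simp (symD (u k) x).
  rewrite (ipC (u k) (D x)) ?(ipC (u k) x).
  lra.
(* Young's inequality splits the cross term; the limit in [k] is taken first, and the freedom in [r]
   then gives the claim. *)
have hr r : 0 < r -> rho * nsq x - ip (D x) x <= r * nsq v.
  move=> r0.
  have cv : (fun k => r * nsq v + (r^-1 + M) * nsq (u k)) @ \oo --> r * nsq v.
    rewrite -[X in _ --> X]addr0; apply: cvgD; first exact: cvg_cst.
    by rewrite -[X in _ --> X](mulr0 (r^-1 + M)); apply: cvgMl_tmp.
  apply: ler_cvg_to (cvg_cst _) cv _; apply: nearW => k.
  by have := hk k; have := young v (u k) r0; lra.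
rewrite -subr_le0 leNgt; apply/negP => lt0.
have v0 := nsq_ge0 v.
have v1 : 0 < 2 * (nsq v + 1) by lra.
move: hr lt0; set d := _ - ip _ _ => hr lt0.
have := hr (d / (2 * (nsq v + 1))); rewrite divr_gt0 // => /(_ isT).
by rewrite mulrAC ler_pdivlMr //; have := mulr_ge0 (ltW lt0) v0; lra.
Qed.

End SpectralGap.

(** * Lower bounds of a form from the resolvent set *)

Section LinearOperator.
Context {R : realType} {E : hilbertSpace R}.
Variable T : operator E.
Hypothesis linT : linear_operator T.
Implicit Types x y : E.

Lemma operator0 : T 0 = 0.
Proof.
have := linT.2 (-1) 0 0 linT.1.1 linT.1.1.
by rewrite scaler0 addr0 scaleN1r addNr.
Qed.

Lemma operatorZ (a : R[i]) x : opdom T x -> T (a *: x) = a *: T x.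
Proof.
by move=> Tx; have := linT.2 a x 0 Tx linT.1.1; rewrite operator0 !addr0.
Qed.

Lemma operatorD x y : opdom T x -> opdom T y -> T (x + y) = T x + T y.
Proof. by move=> Tx Ty; have := linT.2 1 x y Tx Ty; rewrite !scale1r. Qed.

Lemma operatorB x y : opdom T x -> opdom T y -> T (x - y) = T x - T y.
Proof.
move=> Tx Ty; rewrite addrC -scaleN1r linT.2 // scaleN1r addrC //.
Qed.

Lemma operator_sum (I : Type) (s : seq I) (P : pred I) (F : I -> E) :
  (forall i, P i -> opdom T (F i)) ->
  T (\sum_(i <- s | P i) F i) = \sum_(i <- s | P i) T (F i).
Proof.
move=> TF; elim: s => [|i s IH]; first by rewrite !big_nil operator0.
rewrite !big_cons; case: ifPn => // Pi.
by rewrite operatorD ?IH //; [exact: TF|exact: subspace_sum linT.1 TF].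
Qed.

End LinearOperator.

Section FormLowerBound.
Context {R : realType} {E : hilbertSpace R}.
Variables (H S : operator E).
Hypothesis linH : linear_operator H.
Hypothesis formH : forall x, opdom H x -> opdom S x /\
  forall v, opdom S v -> ip (H x) v = ip (S x) (S v).

(** What the lower bounds draw from [t] lying in the resolvent set. *)
Definition bounded_below (t : R) := exists2 c, 0 < c &
  forall x, opdom H x -> c * nsq x <= nsq (H x - t%:C%C *: x).

(** [A] is the resolvent (H + 1)^-1, which replaces the unbounded [H] by an operator between 0 and
    1. *)
Variable A : E -> E.
Hypothesis resA : forall y, opdom H (A y) /\ H (A y) + A y = y.
Hypothesis Ares : forall x, opdom H x -> A (H x + x) = x.

Lemma linear_resolvent : linear A.
Proof.
move=> a x y; have [hx ex] := resA x; have [hy ey] := resA y.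
rewrite -(Ares (linH.1.2 a _ _ hx hy)); congr (A _).
by rewrite linH.2 // addrACA -scalerDr ex ey.
Qed.

Lemma ip_resolvent x v : opdom S v -> ip x v = ip (S (A x)) (S v) + ip (A x) v.
Proof.
by move=> Sv; have [hx {1}<-] := resA x; rewrite ipDl (formH hx).2.
Qed.

Lemma ipsym_resolvent : ipsym A.
Proof.
move=> x y; have [/formH[hx _] _] := resA x; have [/formH[hy _] _] := resA y.
rewrite ipC (ip_resolvent y hx) (ip_resolvent x hy).
by rewrite (ipC (S (A y))) (ipC (A y)).
Qed.

Lemma resolvent_bound x : 0 <= ip (A x) x <= nsq x.
Proof.
have [/formH[hx _] _] := resA x; have := ip_resolvent x hx.
rewrite (ipC x) -/(nsq (S (A x))) -/(nsq (A x)) => e.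
have := nsq_ge0 (S (A x)); have := nsq_ge0 (A x) => h1 h2.
apply/andP; split; first by lra.
by have := nsq_ge0 (x - A x); rewrite nsqD nsqN !ip_simp (ipC x); lra.
Qed.

(** (1 + t)^-1 - A = (1 + t)^-1 (H - t) A. With z = (H - t) A y one has y = z + (1 + t) A y and |A
    y|^2 <= |z|^2 / c, which gives the constant. *)
Lemma resolvent_bounded_below t : 0 <= t -> bounded_below t ->
  exists2 c, 0 < c & forall y, c * nsq y <= nsq ((1 + t)^-1%:C%C *: y - A y).
Proof.
move=> t0 [c c0 hc]; have t1 : 0 < 1 + t by lra.
have M0 : 0 < (1 + t) ^+ 2 * (2 + 2 * (1 + t) ^+ 2 / c).
  rewrite mulr_gt0 ?exprn_gt0 // addr_gt0 // divr_gt0 // mulr_gt0 // exprn_gt0 //.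
exists ((1 + t) ^+ 2 * (2 + 2 * (1 + t) ^+ 2 / c))^-1; first by rewrite invr_gt0.
move=> y; rewrite ler_pdivrMl //; have [hx ey] := resA y.
set z := H (A y) - t%:C%C *: A y.
have -> : (1 + t)^-1%:C%C *: y - A y = (1 + t)^-1%:C%C *: z.
  have -> : A y = (1 + t)^-1%:C%C *: ((1 + t)%:C%C *: A y).
    by rewrite scalerA -rmorphM mulVf ?gt_eqF // scale1r.
  rewrite -scalerBr; congr (_ *: _); rewrite -{1}ey /z; move: (A y) => w.
  by rewrite rmorphD scalerDl scale1r opprD addrA addrK.
have ez : y = z + (1 + t)%:C%C *: A y.
  by rewrite rmorphD scalerDl scale1r /z [X in _ + X]addrC addrA subrK ey.
have -> : (1 + t) ^+ 2 * (2 + 2 * (1 + t) ^+ 2 / c) *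
    nsq ((1 + t)^-1%:C%C *: z) = 2 * nsq z + 2 * ((1 + t) ^+ 2 * (nsq z / c)).
  by rewrite nsqZ; field; rewrite !gt_eqF.
rewrite {1}ez; apply: le_trans (nsqD_le _ _) _; rewrite nsqZ lerD2l ler_pM2l //.
by rewrite ler_pM2l ?exprn_gt0 // ler_pdivlMr // mulrC hc.
Qed.

Variable K : set E.
Hypothesis subK : subspace K.
Hypothesis closedK : forall (u : nat -> E) x, (forall k, K (u k)) ->
  (fun k => nsq (u k - x)) @ \oo --> (0 : R) -> K x.
Hypothesis AK : forall x, K x -> K (A x).

(** A lower bound of 1 - A is the form in which A <= (1 + t0)^-1 on [K] can be raised step by step
    with [quadratic_lower_bound]. *)
Lemma resolvent_upper_bound t0 : 0 < t0 ->
  (forall t, 0 <= t < t0 -> bounded_below t \/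
     (exists2 e, 0 < e & forall r, t < r < t + e -> bounded_below r) /\
     (forall x, K x -> opdom H x -> H x = t%:C%C *: x -> x = 0)) ->
  forall x, K x -> (1 - (1 + t0)^-1) * nsq x <= nsq x - ip (A x) x.
Proof.
move=> t00 alt; apply: (quadratic_lower_bound subK).
  by move=> x _; have /andP[_] := resolvent_bound x; rewrite subr_ge0.
move=> b /andP[b0 bT] hb.
(* The bound [b] on 1 - A corresponds to the bound [t] on [H] through 1 - b = (1 + t)^-1. *)
pose a := 1 - b; have a_gt : (1 + t0)^-1 < a by rewrite /a; lra.
have a0 : 0 < a by apply: lt_trans a_gt; rewrite invr_gt0; lra.
have a1 : a <= 1 by rewrite /a; lra.
pose t := a^-1 - 1.
have at' : (1 + t)^-1 = a by rewrite /t addrC subrK invrK.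
have t_ge0 : 0 <= t by rewrite subr_ge0 invf_ge1.
have t_lt : t < t0.
  rewrite ltrBlDl -[ltRHS]invrK ltf_pV2 ?posrE //.
  by rewrite invr_gt0; lra.
pose D x := a%:C%C *: x - A x.
have ipD x : ip (D x) x = nsq x - ip (A x) x - b * nsq x.
  by rewrite /D !ip_simp -/(nsq x) /a; ring.
have linD : linear D.
  move=> r x y; rewrite /D linear_resolvent scalerDr !scalerBr opprD addrACA.
  by congr (_ - _ + _); rewrite !scalerA mulrC.
have symD : ipsym D by move=> x y; rewrite /D !ip_simp ipsym_resolvent.
have KD x : K x -> K (D x).
  by move=> Kx; apply: subspaceB => //; [exact: subspaceZ|exact: AK].
have boundD x : K x -> 0 <= ip (D x) x <= 1 * nsq x.
  move=> Kx; rewrite ipD mul1r subr_ge0 hb //=.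
  have := mulr_ge0 b0 (nsq_ge0 x); have /andP[] := resolvent_bound x; lra.
have step c : (forall x, K x -> c * nsq x <= ip (D x) x) ->
    forall x, K x -> (b + c) * nsq x <= nsq x - ip (A x) x.
  by move=> h x /h; rewrite ipD; lra.
have [bb|[[e e0 he] inj]] := alt t (introT andP (conj t_ge0 t_lt)).
  have [c c0 hc] := resolvent_bounded_below t_ge0 bb.
  exists c => //; apply: step => x Kx; apply: le_trans (hc x) _; rewrite at'.
  by have := nsq_le_form subK linD symD KD ltr01 boundD Kx; rewrite mul1r.
have f0 : 0 < a^-1 + e by rewrite addr_gt0 ?invr_gt0.
(* As a^-1 = 1 + t, the map r -> (1 + t)^-1 - (1 + r)^-1 sends (t, t + e) onto (0, rho). *)
pose rho := a - (a^-1 + e)^-1.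
have rho0 : 0 < rho by rewrite subr_gt0 -[ltRHS]invrK ltf_pV2 ?posrE ?invr_gt0 // ltrDl.
have rho1 : rho <= 1.
  have : 0 < (a^-1 + e)^-1 by rewrite invr_gt0.
  by rewrite /rho; lra.
exists rho => //; apply: step.
have gap : forall r, 0 < r < rho -> exists2 c, 0 < c &
    forall x, K x -> c * nsq x <= nsq (D x - r%:C%C *: x).
  move=> r /andP[r0 rrho].
  have ar : (a^-1 + e)^-1 < a - r by move: rrho; rewrite /rho; lra.
  have ar0 : 0 < a - r by apply: lt_trans ar; rewrite invr_gt0.
  pose t' := (a - r)^-1 - 1.
  have tt' : t < t' by rewrite ltrD2r ltf_pV2 ?posrE // gtrBl.
  have t'e : t' < t + e.
    rewrite /t addrAC ltrD2r -[ltRHS]invrK ltf_pV2 ?posrE ?invr_gt0 //.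
  have [c c0 hc] := resolvent_bounded_below (ltW (le_lt_trans t_ge0 tt'))
    (he t' (introT andP (conj tt' t'e))).
  exists c => // x _; apply: le_trans (hc x) _.
  rewrite /t' [1 + _]addrC subrK invrK /D rmorphB scalerBl.
  by rewrite addrAC.
apply: (gap_lower_bound subK linD symD KD ltr01 boundD rho0 gap closedK _ rho1).
(* D x = 0 means A x = a x, that is H x = t x, so the hypothesis on eigenvectors in [K] makes the
   kernel trivial. *)
move=> x Kx /eqP; rewrite subr_eq0 => /eqP ex.
have [hA eA] := resA x.
have xA : x = a^-1%:C%C *: A x by rewrite -ex scalerA -rmorphM mulVf ?gt_eqF // scale1r.
have hx : opdom H x by rewrite xA; apply: subspaceZ => //; exact: linH.1.
apply: inj => //.
have HZ : H (A x) = a%:C%C *: H x.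
  by rewrite -ex operatorZ.
have : a%:C%C *: H x = (1 - a)%:C%C *: x.
  by rewrite -HZ rmorphB scalerBl scale1r ex -{2}eA addrK.
move=> /(congr1 (fun z => a^-1%:C%C *: z)).
rewrite !scalerA -!rmorphM mulVf ?gt_eqF // scale1r => ->.
by rewrite mulrBr mulr1 mulVf ?gt_eqF.
Qed.

(** With c = 1 + t0, expand the square of [u - c A u] in the norm of h + 1. There [A u] pairs with
    any [w] as [u] does in the plain inner product, so A <= c^-1 leaves h[u] + |u|^2 >= c |u|^2.
    This reaches the whole form domain. *)
Lemma form_lower_bound t0 :
  (forall t, 0 <= t < t0 -> bounded_below t \/
     (exists2 e, 0 < e & forall r, t < r < t + e -> bounded_below r) /\
     (forall x, K x -> opdom H x -> H x = t%:C%C *: x -> x = 0)) ->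
  forall u, K u -> opdom S u -> t0 * nsq u <= nsq (S u).
Proof.
move=> alt u Ku Su; have [t00|t00] := leP t0 0.
  by apply: le_trans (nsq_ge0 _); rewrite mulr_le0_ge0 ?nsq_ge0.
have ub := resolvent_upper_bound t00 alt Ku; pose c := 1 + t0.
have c0 : 0 < c by rewrite /c; lra.
have [/formH[SA hA] _] := resA u.
have e1 := ip_resolvent u Su; have e2 := ip_resolvent u SA.
have h1 := nsq_ge0 (S u - c%:C%C *: S (A u)).
have h2 := nsq_ge0 (u - c%:C%C *: A u).
rewrite !nsqD !nsqN !nsqZ !ip_simp in h1 h2.
rewrite -/(nsq _) (ipC (S (A u))) in e1; rewrite -/(nsq _) -/(nsq _) (ipC u) in e2.
rewrite (ipC u) in h2; rewrite (ipC (A u)) in e1.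
have h3 : c ^+ 2 * ip (A u) u <= c * nsq u.
  rewrite expr2 -mulrA ler_pM2l //.
  rewrite -(ler_pM2l (_ : 0 < c^-1)) ?invr_gt0 // mulrA mulVf ?gt_eqF // mul1r.
  by move: ub; rewrite -/c; lra.
have h4 : 2 * (c * ip (S u) (S (A u))) + 2 * (c * ip (A u) u) = 2 * c * nsq u.
  by rewrite e1 (ipC u); ring.
have h5 : c ^+ 2 * nsq (S (A u)) + c ^+ 2 * nsq (A u) = c ^+ 2 * ip (A u) u.
  by rewrite e2; ring.
have -> : t0 = c - 1 by rewrite /c; ring.
move: h1 h2 h3 h4 h5; lra.
Qed.

End FormLowerBound.

(** * Orthonormal families and the min-max principle *)

Lemma nontrivial_left_kernel (F : fieldType) (a b : nat) (M : 'M[F]_(a, b)) :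
  (b < a)%N -> exists2 c : 'rV_a, c != 0 & c *m M = 0.
Proof.
move=> ab; have /rowV0Pn[c cM c0] : kermx M != 0.
  rewrite -mxrank_eq0 mxrank_ker -lt0n subn_gt0.
  by apply: leq_ltn_trans ab; exact: rank_leq_col.
by exists c => //; apply/sub_kermxP.
Qed.

Definition abssq {R : realType} (z : R[i]) : R := complex.Re (`|z| ^+ 2).

Section OrthonormalFamilies.
Context {R : realType} {E : hilbertSpace R}.
Implicit Types (W : set E) (x y : E).

Lemma abssqE (z : R[i]) : (abssq z)%:C%C = z * z^*%R.
Proof. by rewrite -normCK /abssq RRe_real // ger0_real // exprn_ge0. Qed.

Lemma abssq_ge0 (z : R[i]) : 0 <= abssq z.
Proof. by rewrite -ler0c abssqE mul_conjC_ge0. Qed.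

Lemma abssq_eq0 (z : R[i]) : (abssq z == 0) = (z == 0).
Proof. by rewrite -(fmorph_eq0 (real_complex R)) /= abssqE mul_conjC_eq0. Qed.

Lemma nsqZ_complex (a : R[i]) x : nsq (a *: x) = abssq a * nsq x.
Proof.
apply: (@complexI R); rewrite [RHS]rmorphM /= abssqE -!innerxx innerZl innerZr.
by rewrite mulrA.
Qed.

Definition orthonormal_family (I : eqType) (f : I -> E) :=
  forall i j, inner E (f i) (f j) = (i == j)%:R.

Lemma inner_diagonal_sum (I : finType) (f g : I -> E) (d : I -> R[i]) (c b : I -> R[i]) :
  (forall i j, inner E (f i) (g j) = (i == j)%:R * d i) ->
  inner E (\sum_i c i *: f i) (\sum_i b i *: g i) = \sum_i c i * (b i)^*%R * d i.
Proof.
move=> fg; rewrite inner_suml; apply: eq_bigr => i _; rewrite inner_sumr.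
rewrite (bigD1 i) //= big1 => [|j ji].
  by rewrite addr0 innerZl innerZr fg eqxx mul1r mulrA.
by rewrite innerZl innerZr fg eq_sym (negPf ji) mul0r !mulr0.
Qed.

Lemma nsq_diagonal_sum (I : finType) (f : I -> E) (d : I -> R) (c : I -> R[i]) :
  (forall i j, inner E (f i) (f j) = (i == j)%:R * (d i)%:C%C) ->
  nsq (\sum_i c i *: f i) = \sum_i abssq (c i) * d i.
Proof.
move=> ff; apply: (@complexI R); rewrite -innerxx (inner_diagonal_sum _ _ ff).
by rewrite rmorph_sum; apply: eq_bigr => i _; rewrite [RHS]rmorphM /= abssqE.
Qed.

Lemma inner_orthonormal_sum (I : finType) (f : I -> E) (c : I -> R[i]) j :
  orthonormal_family f -> inner E (\sum_i c i *: f i) (f j) = c j.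
Proof.
move=> of_; rewrite inner_suml (bigD1 j) //= big1 => [|i ij].
  by rewrite addr0 innerZl of_ eqxx mulr1.
by rewrite innerZl of_ (negPf ij) mulr0.
Qed.

Lemma nsq_orthonormal_sum (I : finType) (f : I -> E) (c : I -> R[i]) :
  orthonormal_family f -> nsq (\sum_i c i *: f i) = \sum_i abssq (c i).
Proof.
move=> of_; rewrite (@nsq_diagonal_sum _ _ (fun=> 1)) => [|i j].
  by apply: eq_bigr => i _; rewrite mulr1.
by rewrite mulr1 of_.
Qed.

Lemma orthonormal_extend W k (f : 'I_k -> E) x : subspace W ->
  (forall i, W (f i)) -> orthonormal_family f -> W x -> x != 0 ->
  (forall i, inner E x (f i) = 0) ->
  exists g : 'I_k.+1 -> E, (forall i, W (g i)) /\ orthonormal_family g.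
Proof.
move=> sW Wf of_ Wx x0 xf.
pose y := (Num.sqrt (nsq x))^-1%:C%C *: x.
have nx : 0 < nsq x by rewrite nsq_gt0.
have yy : inner E y y = 1.
  rewrite innerxx nsqZ exprVn sqr_sqrtr ?nsq_ge0 // mulVf ?gt_eqF //.
have yf i : inner E y (f i) = 0 by rewrite innerZl xf mulr0.
exists (fun i => if unlift ord_max i is Some j then f j else y); split.
  by move=> i; case: unliftP => // _; apply: subspaceZ.
move=> i j; case: unliftP => [i' ->|->]; case: unliftP => [j' ->|->].
- by rewrite of_ (inj_eq lift_inj).
- by rewrite (inner_eq0C (yf _)) eq_sym (negPf (neq_lift _ _)).
- by rewrite yf (negPf (neq_lift _ _)).
- by rewrite yy eqxx.
Qed.

Lemma has_dim_subspace W m : has_dim W m -> subspace W.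
Proof.
move=> [phi [_ <-]]; split; first by exists 0; rewrite ?linear0.
by move=> a x y [u _ <-] [v _ <-]; exists (a *: u + v); rewrite ?linearP.
Qed.

(** Induction on [k]: the [m] coordinates of a vector of [W] outnumber the [k] orthogonality
    conditions, so a nonzero vector is left to extend the family. *)
Lemma has_dim_orthonormal_le W m k : has_dim W m -> (k <= m)%N ->
  exists f : 'I_k -> E, (forall i, W (f i)) /\ orthonormal_family f.
Proof.
move=> dW; have sW := has_dim_subspace dW; have [phi [phi_inj ranphi]] := dW.
elim: k => [_|k IH km]; first by exists (fun=> 0); split=> [|i]; case.
have [f [Wf of_]] := IH (ltnW km).
have [c c0 cM] := nontrivial_left_kernel
  (\matrix_(l < m, i < k) inner E (phi (delta_mx 0 l)) (f i)) km.
apply: (orthonormal_extend (x := phi c) sW Wf of_).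
- by rewrite -ranphi; exists c.
- by apply: contra c0 => /eqP e; apply/eqP/phi_inj; rewrite e linear0.
move=> i; have /rowP/(_ i) := cM; rewrite !mxE => <-.
rewrite {1}(row_sum_delta c) linear_sum inner_suml; apply: eq_bigr => l _.
by rewrite linearZ innerZl mxE.
Qed.

Lemma has_dim_orthonormal_ge W m k (f : 'I_k -> E) : has_dim W m ->
  (forall i, W (f i)) -> orthonormal_family f -> (k <= m)%N.
Proof.
move=> [phi [phi_inj ranphi]] Wf of_; rewrite leqNgt; apply/negP => mk.
have /choice[a ha] : forall i, exists u, phi u = f i.
  by move=> i; have := Wf i; rewrite -ranphi => -[u _ <-]; exists u.
have [c /eqP c0 cM] := nontrivial_left_kernel (\matrix_i a i) mk.
apply: c0; apply/rowP => i; rewrite mxE -(inner_orthonormal_sum (c 0) i of_).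
have -> : \sum_i c 0 i *: f i = phi (c *m \matrix_i a i).
  rewrite mulmx_sum_row linear_sum; apply: eq_bigr => j _.
  by rewrite linearZ rowK ha.
by rewrite cM linear0 inner0l.
Qed.

Lemma orthonormal_complete W m (f : 'I_m -> E) x : has_dim W m ->
  (forall i, W (f i)) -> orthonormal_family f -> W x ->
  (forall i, inner E x (f i) = 0) -> x = 0.
Proof.
move=> dW Wf of_ Wx xf; apply/eqP; apply: contraT => x0.
have [g [Wg og]] := orthonormal_extend (has_dim_subspace dW) Wf of_ Wx x0 xf.
by have := has_dim_orthonormal_ge dW Wg og; rewrite ltnn.
Qed.

Lemma has_dim_orthonormal_basis W m : has_dim W m ->
  exists f : 'I_m -> E, [/\ forall i, W (f i), orthonormal_family f &
    forall x, W x -> (forall i, inner E x (f i) = 0) -> x = 0].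
Proof.
move=> dW; have [f [Wf of_]] := has_dim_orthonormal_le dW (leqnn m).
by exists f; split=> // x; apply: orthonormal_complete.
Qed.

Lemma has_dim_projection W m x : has_dim W m ->
  exists2 y, W y & forall w, W w -> inner E (x - y) w = 0.
Proof.
move=> dW; have sW := has_dim_subspace dW.
have [f [Wf of_ cf]] := has_dim_orthonormal_basis dW.
have proj z i : inner E (z - \sum_i inner E z (f i) *: f i) (f i) = 0.
  by rewrite innerBl inner_orthonormal_sum // subrr.
have Wsum z : W (\sum_i inner E z (f i) *: f i).
  by apply: subspace_sum => // i _; apply: subspaceZ.
exists (\sum_i inner E x (f i) *: f i) => // w Ww.
have /eqP := cf _ (subspaceB sW Ww (Wsum w)) (proj w); rewrite subr_eq0 => /eqP ->.
by rewrite inner_sumr big1 // => i _; rewrite innerZr proj mulr0.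
Qed.

Lemma has_dim_nonzero W m : has_dim W m -> (0 < m)%N -> exists2 x, W x & x != 0.
Proof.
move=> [phi [phi_inj <-]] m0; exists (phi (delta_mx 0 (Ordinal m0))).
  by exists (delta_mx 0 (Ordinal m0)).
rewrite -(linear0 phi) (inj_eq phi_inj); apply/eqP => /rowP/(_ (Ordinal m0)).
by rewrite !mxE !eqxx => /eqP; rewrite oner_eq0.
Qed.

End OrthonormalFamilies.

(** * Eigenvectors of the discrete spectrum and the min-max bound *)

Section MinMax.
Context {R : realType} {E : hilbertSpace R}.
Variables (H S : operator E) (lam : nat -> \bar R).
Hypothesis saH : selfadjoint H.
Hypothesis sqrtS : is_sqrt S H.
Hypothesis lamH : discrete_eigenvalues H lam.
Hypothesis lam_e0 : (0 < lambda_e H)%E.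

Lemma selfadjointP (T : operator E) : selfadjoint T ->
  forall x y, opdom T x -> opdom T y -> inner E (T x) y = inner E x (T y).
Proof. by case=> _ _ h x y Tx Ty; exact: ((h y (T y)).2 (conj Ty erefl) x Tx). Qed.

Lemma form_sqrt x v : opdom H x -> opdom S v -> inner E (H x) v = inner E (S x) (S v).
Proof.
case: sqrtS => saS _ [domH HS] Hx Sv.
have [Sx SSx] : opdom S x /\ opdom S (S x) by have := Hx; rewrite domH.
by rewrite HS // (selfadjointP saS).
Qed.

Lemma opdom_sqrt x : opdom H x -> opdom S x.
Proof. by case: sqrtS => _ _ [-> _] []. Qed.

Lemma formP x : opdom H x -> opdom S x /\
  forall v, opdom S v -> ip (H x) v = ip (S x) (S v).
Proof.
by move=> Hx; split=> [|v Sv]; [exact: opdom_sqrt|rewrite /ip form_sqrt].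
Qed.

Let linH : linear_operator H. Proof. by case: saH. Qed.
Let linS : linear_operator S. Proof. by case: sqrtS => -[]. Qed.

Lemma eigenvalue_ge0 (t : R) x : opdom H x -> H x = t%:C%C *: x -> x != 0 -> 0 <= t.
Proof.
move=> Hx ex x0; have [Sx /(_ _ Sx)] := formP Hx.
rewrite ex ipZl => e; have := nsq_ge0 (S x); rewrite /nsq -e.
by rewrite pmulr_lge0 // nsq_gt0.
Qed.

Lemma eigenvalue_fin p : (0 < p)%N -> (lam p < lambda_e H)%E ->
  lam p = (fine (lam p))%:E.
Proof.
case: lamH => _ bnd _ p0 pe; rewrite fineK // fin_real //.
by case/andP: (bnd p p0) => -> _; rewrite (lt_le_trans pe) // leey.
Qed.

Lemma lam_ge0 p : (0 < p)%N -> (0 <= lam p)%E.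
Proof.
case: lamH => _ bnd cnt p0; have /andP[_] := bnd p p0.
rewrite le_eqVlt => /predU1P[->|pe]; first exact: ltW.
have ep := eigenvalue_fin p0 pe; rewrite ep lee_fin.
rewrite ep in pe; have [m [dm /card_set_bijP[f [f_fun _ _]]]] := cnt _ pe.
have m0 : (0 < m)%N by apply: leq_ltn_trans (f_fun p (conj p0 ep)).
have [x [Hx ex] x0] := has_dim_nonzero dm m0.
exact: eigenvalue_ge0 Hx ex x0.
Qed.

(* The condition on [t] comes after [exists] for the sake of [choice]. *)
Lemma eigenspace_family (t : R) : exists g : nat -> E, (t%:E < lambda_e H)%E ->
  [/\ forall p, (0 < p)%N -> lam p = t%:E -> eigenspace H t%:C%C (g p),
      forall p r, (0 < p)%N -> (0 < r)%N -> lam p = t%:E -> lam r = t%:E ->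
        inner E (g p) (g r) = (p == r)%:R &
      forall x, eigenspace H t%:C%C x ->
        (forall p, (0 < p)%N -> lam p = t%:E -> inner E x (g p) = 0) -> x = 0].
Proof.
have [te|/negP te] := boolP (t%:E < lambda_e H)%E; last by exists (fun=> 0).
case: lamH => _ _ /(_ _ te)[m [dm /card_set_bijP[phi [phi_fun phi_inj phi_surj]]]].
have [f [Wf of_ cf]] := has_dim_orthonormal_basis dm.
(* [phi] numbers the positions of [t] in [lam] from 0, and each position receives the basis vector
   with its number; 0 is a filler elsewhere. *)
exists (fun p => if insub (phi p) is Some i then f i else 0) => _.
have phiP p : (0 < p)%N -> lam p = t%:E ->
    exists2 i : 'I_m, i = phi p :> nat & insub (phi p) = Some i.
  move=> p0 ep; have pm : (phi p < m)%N by apply: (phi_fun p).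
  by exists (Ordinal pm) => //; rewrite insubT.
split=> [p p0 ep|p r p0 r0 ep er|x Wx xg].
- by have [i _ ->] := phiP p p0 ep.
- have [i ei ->] := phiP p p0 ep; have [j ej ->] := phiP r r0 er.
  rewrite of_ -val_eqE /= ei ej; congr (_%:R); congr nat_of_bool.
  by apply/eqP/eqP => [|-> //]; apply: phi_inj; rewrite inE /=.
- apply: cf => // i; have [p [p0 ep] ei] := phi_surj i (ltn_ord i).
  have := xg p p0 ep; have [j ej ->] := phiP p p0 ep.
  by move=> <-; congr (inner E x (f _)); apply: val_inj; rewrite /= ej.
Qed.

(** The bases of the eigenspaces are glued along [lam]: vectors for equal eigenvalues are
    orthonormal by choice, those for distinct ones by symmetry of [H]. *)
Lemma eigenvector_family : exists e : nat -> E,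
  [/\ forall p, (0 < p)%N -> (lam p < lambda_e H)%E ->
        opdom H (e p) /\ H (e p) = (fine (lam p))%:C%C *: e p,
      forall p r, (0 < p)%N -> (0 < r)%N -> (lam p < lambda_e H)%E ->
        (lam r < lambda_e H)%E -> inner E (e p) (e r) = (p == r)%:R &
      forall (t : R) x, (t%:E < lambda_e H)%E -> opdom H x -> H x = t%:C%C *: x ->
        (forall p, (0 < p)%N -> lam p = t%:E -> inner E x (e p) = 0) -> x = 0].
Proof.
have [g gP] := choice eigenspace_family.
exists (fun p => g (fine (lam p)) p).
have lt_fin p (p0 : (0 < p)%N) (pe : (lam p < lambda_e H)%E) :
  ((fine (lam p))%:E < lambda_e H)%E by rewrite -eigenvalue_fin.
have eig p : (0 < p)%N -> (lam p < lambda_e H)%E ->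
    eigenspace H (fine (lam p))%:C%C (g (fine (lam p)) p).
  move=> p0 pe; have [h _ _] := gP _ (lt_fin p p0 pe).
  by apply: h; rewrite -?eigenvalue_fin.
split=> [//|p r p0 r0 pe re|t x te Hx ex xe].
- have [epr|npr] := eqVneq (fine (lam p)) (fine (lam r)).
    have [_ h _] := gP _ (lt_fin p p0 pe).
    have er : lam r = (fine (lam p))%:E by rewrite epr -eigenvalue_fin.
    by rewrite -epr; apply: h => //; exact: eigenvalue_fin.
  have -> : (p == r) = false by apply: contraNF npr => /eqP ->.
  have [Hp ep] := eig p p0 pe; have [Hr er] := eig r r0 re.
  have := selfadjointP saH Hp Hr; rewrite ep er innerZl innerZr.
  rewrite (CrealP _) ?complex_real // => /eqP; rewrite -subr_eq0 -mulrBl mulf_eq0.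
  by rewrite -rmorphB fmorph_eq0 subr_eq0 (negPf npr) /= => /eqP.
- have [_ _ h] := gP _ te; apply: h => // p p0 ep; have := xe p p0 ep.
  by rewrite ep.
Qed.

(** On the span of the first [m] eigenvectors the form is diagonal with entries at most lam_m.
    ['I_m] starts at 0 and [lam] at 1, hence the shift. *)
Lemma eigenvector_span m (l : R) : (0 < m)%N -> lam m = l%:E -> (l%:E < lambda_e H)%E ->
  exists e : 'I_m -> E, [/\ orthonormal_family e, forall i, opdom S (e i) &
    forall c : 'I_m -> R[i],
      nsq (S (\sum_i c i *: e i)) <= l * nsq (\sum_i c i *: e i)].
Proof.
move=> m0 lm le; have [e [eige oe _]] := eigenvector_family.
have [mono _ _] := lamH.
have lt_e (i : 'I_m) : (lam i.+1 < lambda_e H)%E.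
  by apply: le_lt_trans le; rewrite -lm; apply: mono; rewrite ltnS ltn_ord.
pose d (i : 'I_m) := fine (lam i.+1).
have dl i : d i <= l.
  by rewrite -lee_fin -eigenvalue_fin // -lm; apply: mono; rewrite ltnS ltn_ord.
have oe' : orthonormal_family (fun i : 'I_m => e i.+1).
  by move=> i j; rewrite oe // eqSS.
have Se (i : 'I_m) : opdom S (e i.+1).
  by apply: opdom_sqrt; exact: (eige i.+1 isT (lt_e i)).1.
have formS (i j : 'I_m) :
    inner E (S (e i.+1)) (S (e j.+1)) = (i == j)%:R * (d i)%:C%C.
  have [hi ei] := eige i.+1 isT (lt_e i).
  by rewrite -form_sqrt // ei innerZl oe' mulrC.
exists (fun i => e i.+1); split=> // c.
have -> : S (\sum_i c i *: e i.+1) = \sum_i c i *: S (e i.+1).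
  rewrite (operator_sum linS) => [|i _]; last by apply: subspaceZ; [exact: linS.1|].
  by apply: eq_bigr => i _; rewrite operatorZ.
rewrite (nsq_diagonal_sum _ formS) (nsq_orthonormal_sum _ oe') mulr_sumr.
by apply: ler_sum => i _; rewrite mulrC ler_wpM2r ?abssq_ge0.
Qed.

Lemma resolvent_bounded_below_at (t : R) : resolvent_set H t%:C%C -> bounded_below H t.
Proof.
move=> [B [_ BH [M hM]]].
(* The bound [M] in [resolvent_set] is a complex number; [m] is a positive real above its
   modulus. *)
pose m := complex.Re `|M| + 1.
have m0 : 0 < m by rewrite ltr_wpDl // -ler0c RRe_real ?normr_real.
exists (m ^- 2) => [|x Hx]; first by rewrite invr_gt0 exprn_gt0.
rewrite ler_pdivrMl ?exprn_gt0 // -lecR [leRHS]rmorphM /= !nsq_norm rmorphXn -exprMn.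
rewrite ler_pXn2r ?nnegrE ?mulr_ge0 ?ler0c ?(ltW m0) //.
rewrite -{1}(BH _ Hx); apply: le_trans (hM _) _.
rewrite -[leLHS]ger0_norm ?(le_trans _ (hM _)) // normrM normr_id.
apply: ler_wpM2r => //.
by rewrite -[leLHS]RRe_real ?normr_real // lecR /m lerDl.
Qed.

Lemma below_lambda_e (t : R) : (t%:E < lambda_e H)%E -> ~ discrete_spectrum H t%:C%C ->
  resolvent_set H t%:C%C.
Proof.
move=> te nd; apply: contrapT => nr; move: te; rewrite ltNge => /negP; apply.
by apply: ereal_inf_lbound; exists t.
Qed.

(** As [lambda_e H] is positive, a negative point of the spectrum would be a discrete eigenvalue,
    which a nonnegative operator does not have. At -1 this supplies (H + 1)^-1. *)
Lemma negative_resolvent (t : R) : t < 0 -> resolvent_set H t%:C%C.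
Proof.
move=> t0; apply: below_lambda_e; first by apply: lt_trans lam_e0; rewrite lte_fin.
move=> [_ _ [m [m0 dm]]]; have [x [Hx ex] x0] := has_dim_nonzero dm m0.
by move: t0; rewrite ltNge (eigenvalue_ge0 Hx ex x0).
Qed.

Lemma bessel1 (x e : E) : inner E e e = 1 -> abssq (inner E x e) <= nsq x.
Proof.
move=> ee; pose y := x - inner E x e *: e.
have ye : inner E y (inner E x e *: e) = 0.
  by rewrite innerZr innerBl innerZl ee mulr1 subrr mulr0.
have -> : x = y + inner E x e *: e by rewrite subrK.
have nsqe : nsq e = 1 by apply: (@complexI R); rewrite -innerxx ee.
rewrite (nsqD_orth ye) nsqZ_complex nsqe mulr1 /y subrK.
by rewrite lerDr nsq_ge0.
Qed.

(** The upper half of the min-max principle. With the first k - 1 eigenvectors as constraints, lam_k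
    > t would bound the form below by some t0 > t on their orthogonal complement, against the trial
    vector. *)
Lemma eigenvalue_le k (t : R) : (0 < k)%N ->
  (forall f : nat -> E, exists w, [/\ opdom S w, w != 0,
     forall p, (0 < p < k)%N -> inner E w (f p) = 0 & nsq (S w) <= t * nsq w]) ->
  (lam k <= t%:E)%E.
Proof.
move=> k0 trial; rewrite leNgt; apply/negP => tk.
have [t0 tt0 t0k] : exists2 t0 : R, t < t0 & (t0%:E < lam k)%E.
  case: (lam k) tk => [r| |//]; last by exists (t + 1); rewrite ?ltrDl ?ltry.
  by rewrite lte_fin => tr; exists ((t + r) / 2); rewrite ?lte_fin; lra.
have [e [eige oe ce]] := eigenvector_family.
have [w [Sw w0 we hw]] := trial e.
have [mono bnd _] := lamH; have /andP[_ ke] := bnd k k0.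
(* Positions filled with the value [lambda_e H] impose no condition. *)
pose K := [set x | forall p, (0 < p < k)%N -> (lam p < lambda_e H)%E ->
  inner E x (e p) = 0].
have subK : subspace K.
  split=> [p _ _|a x y Kx Ky p pk pe]; first exact: inner0l.
  by rewrite innerDl innerZl Kx // Ky // mulr0 addr0.
have closedK (u : nat -> E) x : (forall j, K (u j)) ->
    (fun j => nsq (u j - x)) @ \oo --> (0 : R) -> K x.
  move=> Ku ux p pk pe; apply/eqP; rewrite -abssq_eq0 eq_le abssq_ge0 andbT.
  apply: ler_cvg_to (cvg_cst _) ux _; apply: nearW => j.
  have p0 : (0 < p)%N by case/andP: pk.
  have := bessel1 (u j - x) (_ : inner E (e p) (e p) = 1).
  rewrite innerBl Ku // sub0r /abssq normrN; apply.
  by rewrite oe // eqxx.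
have [A [resA0 Ares0 _]] := negative_resolvent (ltrN10 R).
have resA y : opdom H (A y) /\ H (A y) + A y = y.
  by have [h] := resA0 y; rewrite rmorphN rmorph1 scaleN1r opprK.
have Ares x : opdom H x -> A (H x + x) = x.
  by move=> /Ares0; rewrite rmorphN rmorph1 scaleN1r opprK.
(* (x, e_p) = (1 + lam_p) (A x, e_p), and 1 + lam_p is positive. *)
have AK x : K x -> K (A x).
  move=> Kx p pk pe; have p0 : (0 < p)%N by case/andP: pk.
  have [hA eA] := resA x; have [hp ep] := eige p p0 pe.
  have := Kx p pk pe; rewrite -{1}eA innerDl (selfadjointP saH hA hp) ep innerZr.
  rewrite (CrealP _) ?complex_real // -[X in _ + X]mul1r -mulrDl => /eqP.
  rewrite mulf_eq0 -(rmorph1 (real_complex R)) -rmorphD fmorph_eq0 => /orP[|/eqP //].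
  by rewrite gt_eqF // ltr_wpDl // fine_ge0 // lam_ge0.
(* Below lam_k <= lambda_e(H) the spectrum is discrete. An eigenvector in [K] for r < lam_k
   vanishes, because monotonicity places all indices of the eigenvalue [r] below [k]. *)
have alt r : 0 <= r < t0 -> bounded_below H r \/
     (exists2 d, 0 < d & forall s, r < s < r + d -> bounded_below H s) /\
     (forall x, K x -> opdom H x -> H x = r%:C%C *: x -> x = 0).
  move=> /andP[r0 rt0].
  have rk : (r%:E < lam k)%E by apply: lt_trans t0k; rewrite lte_fin.
  have re : (r%:E < lambda_e H)%E := lt_le_trans rk ke.
  have [ds|nds] := pselect (discrete_spectrum H r%:C%C); last first.
    by left; apply: resolvent_bounded_below_at; apply: below_lambda_e.
  right; split.
    have [_ [d [d0 isolated]] _] := ds; exists d => // s /andP[rs sd].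
    apply: resolvent_bounded_below_at; apply: contrapT => /isolated.
    rewrite -rmorphB ger0_norm ?ler0c ?subr_ge0 ?(ltW rs) // ltcR ltrBlDl sd.
    by move=> /(_ isT) /complexI sr; move: rs; rewrite sr ltxx.
  move=> x Kx Hx ex; apply: (ce _ _ re Hx ex) => p p0 ep; apply: Kx; last by rewrite ep.
  rewrite p0 /= ltnNge; apply/negP => kp.
  have := mono k p; rewrite k0 kp => /(_ isT); rewrite ep => /(lt_le_trans rk).
  by rewrite ltxx.
have := form_lower_bound linH formP resA Ares subK closedK AK alt _ Sw.
rewrite leNgt => /(_ _)/negP; apply.
  by move=> p pk _; exact: we.
by apply: le_lt_trans hw _; rewrite ltr_pM2r ?nsq_gt0.
Qed.

End MinMax.

(** * Trial vectors *)

Section TrialVector.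
Context {R : realType} {E : hilbertSpace R}.
Variables (S : operator E) (n : nat) (u : 'I_n -> E) (mu : 'I_n -> R).
Variables (W : set E) (s : R).
Hypothesis linS : linear_operator S.
Hypothesis ou : orthonormal_family u.
Hypothesis subW : subspace W.
Hypothesis Wu : forall i, W (u i).
Hypothesis Su : forall i, opdom S (u i).
Hypothesis ritz : forall i j, inner E (S (u i)) (S (u j)) = (i == j)%:R * (mu i)%:C%C.
Hypothesis mu_mono : forall i j : 'I_n, (i <= j)%N -> mu i <= mu j.
Hypothesis s_ge0 : 0 <= s.
Hypothesis s_lt1 : s < 1.
Hypothesis angle : forall a v, W a -> opdom S v -> (forall i, inner E v (u i) = 0) ->
  2 * ip (S a) (S v) <= s * (nsq (S a) + nsq (S v)).

Definition ritz_proj x : E := \sum_i inner E x (u i) *: u i.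

Lemma ritz_proj_orth x i : inner E (x - ritz_proj x) (u i) = 0.
Proof. by rewrite innerBl inner_orthonormal_sum // subrr. Qed.

Lemma ritz_proj_sum (I : Type) (r : seq I) (c : I -> R[i]) (F : I -> E) :
  ritz_proj (\sum_(k <- r) c k *: F k) = \sum_(k <- r) c k *: ritz_proj (F k).
Proof.
under [RHS]eq_bigr do rewrite scaler_sumr.
rewrite exchange_big; apply: eq_bigr => i _ /=.
rewrite inner_suml scaler_suml; apply: eq_bigr => k _.
by rewrite innerZl scalerA.
Qed.

Lemma W_sum (I : Type) (r : seq I) (c : I -> R[i]) (h : I -> 'I_n) :
  W (\sum_(k <- r) c k *: u (h k)).
Proof. by apply: subspace_sum => // k _; apply: subspaceZ. Qed.

Lemma S_sum (I : Type) (r : seq I) (c : I -> R[i]) (h : I -> 'I_n) :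
  opdom S (\sum_(k <- r) c k *: u (h k)) /\
  S (\sum_(k <- r) c k *: u (h k)) = \sum_(k <- r) c k *: S (u (h k)).
Proof.
have dom k : opdom S (c k *: u (h k)) by apply: subspaceZ; [exact: linS.1|].
split; first by apply: subspace_sum => //; exact: linS.1.
by rewrite (operator_sum linS) //; apply: eq_bigr => k _; rewrite operatorZ.
Qed.

(** [angle] at [a] and at [- a] bounds the cross term from both sides. *)
Lemma angle_block a v : W a -> opdom S a -> opdom S v ->
  (forall i, inner E v (u i) = 0) ->
  (1 - s) * (nsq (S a) + nsq (S v)) <= nsq (S (a + v)) <=
  (1 + s) * (nsq (S a) + nsq (S v)).
Proof.
move=> Wa Sa Sv vu; rewrite operatorD // nsqD.
have h1 := angle Wa Sv vu.
have := angle (subspaceZ (-1) subW Wa) Sv vu.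
rewrite operatorZ // scaleN1r nsqN ipNl => h2.
by apply/andP; split; lra.
Qed.

Lemma trial_vector (m : nat) (e : 'I_m -> E) (l : R) (j r : 'I_n) (f : nat -> E) :
  orthonormal_family e -> (forall i, opdom S (e i)) ->
  (forall c : 'I_m -> R[i],
     nsq (S (\sum_i c i *: e i)) <= l * nsq (\sum_i c i *: e i)) ->
  (j <= m)%N -> (j <= r)%N -> 0 <= l < (1 - s) * mu j ->
  exists w, [/\ opdom S w, w != 0,
    forall p, (0 < p < (m - j + r).+1)%N -> inner E w (f p) = 0 &
    nsq (S w) <= (1 + s) * mu r * nsq w].
Proof.
move=> oe Se hl jm jr /andP[l0 lj].
pose U (k : 'I_r.+1) := u (widen_ord (ltn_ord r) k).
(* The unknown vector combines the [e i], projected off the Ritz vectors, with the first r + 1 Ritz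
   vectors. [q] keeps the unprojected part alone, as orthogonality to the first [j] Ritz vectors is
   imposed before projecting. *)
pose q (k : 'I_(m + r.+1)) := if fintype.split k is inl i then e i else 0.
pose w (k : 'I_(m + r.+1)) :=
  match fintype.split k with inl i => e i - ritz_proj (e i) | inr i => U i end.
pose M := \matrix_(k < m + r.+1, t < j + (m - j + r))
  match fintype.split t with
  | inl i => inner E (q k) (u (widen_ord (ltnW (ltn_ord j)) i))
  | inr p => inner E (w k) (f p.+1)
  end.
(* One coefficient more than constraints: m + r + 1 against j + (m - j + r). *)
have bound : (j + (m - j + r) < m + r.+1)%N by rewrite addnA subnKC // addnS.
have [y y0 yM] := nontrivial_left_kernel M bound.
pose c i := y 0 (lshift r.+1 i); pose b i := y 0 (rshift m i).
pose Q := \sum_i c i *: e i; pose a := \sum_i b i *: U i.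
pose v := Q - ritz_proj Q.
have QE : \sum_k y 0 k *: q k = Q.
  rewrite big_split_ord /= [X in _ + X]big1 => [|i _].
    by rewrite addr0; apply: eq_bigr => i _; rewrite /q (unsplitK (inl i)).
  by rewrite /q (unsplitK (inr i)) scaler0.
have wE : \sum_k y 0 k *: w k = v + a.
  rewrite big_split_ord /=; congr (_ + _); last first.
    by apply: eq_bigr => i _; rewrite /w (unsplitK (inr i)).
  rewrite /v /Q ritz_proj_sum -sumrB; apply: eq_bigr => i _.
  by rewrite /w (unsplitK (inl i)) scalerBr.
have Qu (i : 'I_n) : (i < j)%N -> inner E Q (u i) = 0.
  move=> ij; have /rowP/(_ (lshift _ (Ordinal ij))) := yM.
  rewrite !mxE -QE inner_suml => h; rewrite -[RHS]h; apply: eq_bigr => k _.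
  rewrite mxE (unsplitK (inl (Ordinal ij))) innerZl; congr (_ * inner E _ (u _)).
  exact: val_inj.
have wf p : (0 < p < (m - j + r).+1)%N -> inner E (v + a) (f p) = 0.
  case: p => // p /andP[_ pm].
  have /rowP/(_ (rshift _ (Ordinal (pm : (p < m - j + r)%N)))) := yM.
  rewrite !mxE -wE inner_suml => h; rewrite -[RHS]h; apply: eq_bigr => k _.
  by rewrite mxE (unsplitK (inr (Ordinal _))) innerZl.
have SQ : opdom S Q.
  apply: subspace_sum => [|i _]; first exact: linS.1.
  by apply: subspaceZ; [exact: linS.1|].
have [SP SPE] := S_sum (index_enum _) (fun i => inner E Q (u i)) id.
have Sv : opdom S v by apply: subspaceB => //; exact: linS.1.
have vu : forall i, inner E v (u i) = 0 by exact: ritz_proj_orth.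
have WP : W (ritz_proj Q) by exact: (W_sum _ _ id).
have Wa : W a by exact: (W_sum _ _ (widen_ord (ltn_ord r))).
have [Sa SaE] := S_sum (index_enum _) b (widen_ord (ltn_ord r)).
have vW : inner E (ritz_proj Q) v = 0.
  by rewrite inner_suml big1 // => i _; rewrite innerZl (inner_eq0C (vu i)) mulr0.
have nQ : nsq Q = nsq (ritz_proj Q) + nsq v.
  by rewrite -(nsqD_orth vW) addrC subrK.
have nSP : mu j * nsq (ritz_proj Q) <= nsq (S (ritz_proj Q)).
  rewrite SPE (nsq_diagonal_sum _ ritz) (nsq_orthonormal_sum _ ou) mulr_sumr.
  apply: ler_sum => i _; rewrite mulrC; have [ij|ji] := ltnP i j.
    by rewrite Qu // /abssq normr0 expr0n /= !mul0r.
  by rewrite ler_wpM2l ?abssq_ge0 // mu_mono.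
have oU : orthonormal_family U.
  by move=> i k; rewrite /U ou -val_eqE.
have nSa : nsq (S a) <= mu r * nsq a.
  have ritzU (i k : 'I_r.+1) : inner E (S (U i)) (S (U k)) =
      (i == k)%:R * (mu (widen_ord (ltn_ord r) i))%:C%C.
    by rewrite ritz -val_eqE.
  rewrite SaE (nsq_diagonal_sum _ ritzU) (nsq_orthonormal_sum _ oU) mulr_sumr.
  apply: ler_sum => i _; rewrite mulrC ler_wpM2r ?abssq_ge0 // mu_mono //=.
  by rewrite -ltnS.
have /andP[+ _] := angle_block WP SP Sv vu.
rewrite addrC [ritz_proj Q + v]addrC subrK => hQ.
have {}hQ := le_trans hQ (hl c); rewrite -/Q nQ in hQ.
have va0 : inner E v a = 0 by rewrite inner_sumr big1 // => i _; rewrite innerZr vu mulr0.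
have na : nsq (v + a) = nsq v + nsq a by rewrite nsqD_orth.
set al := nsq (ritz_proj Q) in nQ nSP hQ; set be := nsq v in nQ hQ na.
have s1 : 0 < 1 - s by rewrite subr_gt0.
have hP : (1 - s) * (mu j * al) <= (1 - s) * nsq (S (ritz_proj Q)) by rewrite ler_pM2l.
have d0 : 0 < (1 - s) * mu j - l by rewrite subr_gt0.
have al0 : 0 <= al by exact: nsq_ge0.
have be0 : 0 <= be by exact: nsq_ge0.
(* With P the Ritz projection: (1 - s) (h[PQ] + h[v]) <= h[Q] <= l (|PQ|^2 + |v|^2), and h[PQ] >=
   mu_j |PQ|^2 because [Q] has no component along the first [j] Ritz vectors. *)
have hmain : (1 - s) * nsq (S v) + ((1 - s) * mu j - l) * al <= l * be.
  by move: hQ hP; lra.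
have nSv : nsq (S v) <= mu j * be.
  rewrite -(ler_pM2l s1); have := mulr_ge0 (ltW d0) al0.
  have := mulr_ge0 (ltW d0) be0; lra.
exists (v + a); split => //.
- by apply: subspaceD => //; exact: linS.1.
(* Here l < (1 - s) mu_j enters strictly: if v + a = 0, then v = a = 0, and [hmain] forces PQ = 0;
   so [Q] vanishes too, and with it all coefficients. *)
- apply/negP => /eqP va; move: na; rewrite va nsq0 => /esym/eqP.
  rewrite paddr_eq0 ?nsq_ge0 // => /andP[/eqP be00 a00].
  have Q0 : nsq Q = 0.
    rewrite nQ be00 addr0; apply/eqP; rewrite eq_le al0 andbT -(pmulr_rle0 _ d0).
    have := mulr_ge0 (ltW s1) (nsq_ge0 (S v)); move: hmain; rewrite be00 mulr0; lra.
  move/eqP: y0; apply; apply/rowP => k; rewrite mxE.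
  rewrite -[k]splitK; case: (fintype.split k) => i /=.
    have /eqP := Q0; rewrite nsq_eq0 => /eqP /(congr1 (fun x => inner E x (e i))).
    by rewrite inner_orthonormal_sum // inner0l.
  move: a00; rewrite nsq_eq0 => /eqP /(congr1 (fun x => inner E x (U i))).
  by rewrite inner_orthonormal_sum // inner0l.
- have /andP[_] := angle_block Wa Sa Sv vu; rewrite [a + v]addrC => h.
  apply: le_trans h _; rewrite -mulrA ler_pM2l; last by rewrite ltr_wpDr.
  rewrite na mulrDr addrC lerD //; apply: le_trans nSv _.
  by rewrite ler_wpM2r // mu_mono.
Qed.

End TrialVector.

(** * Ritz vectors *)

Section RitzVectors.
Context {R : realType}.
Local Open Scope sesquilinear_scope.

Lemma char_poly_trmx (F : comNzRingType) n (A : 'M[F]_n) : char_poly A^T = char_poly A.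
Proof.
rewrite /char_poly -[RHS]det_tr /char_poly_mx; congr (\det _).
by apply/matrixP => i j; rewrite !mxE eq_sym.
Qed.

Lemma char_poly_conj (F : fieldType) n (P A : 'M[F]_n) : P \in unitmx ->
  char_poly (invmx P *m A *m P) = char_poly A.
Proof.
move=> Pu; rewrite /char_poly.
have PP : map_mx polyC (invmx P) *m map_mx polyC P = 1%:M.
  by rewrite -map_mxM mulVmx // map_mx1.
have -> : char_poly_mx (invmx P *m A *m P) =
    map_mx polyC (invmx P) *m char_poly_mx A *m map_mx polyC P.
  rewrite /char_poly_mx mulmxBr mulmxBl -!map_mxM; congr (_ - _).
  by rewrite mul_mx_scalar -scalemxAl PP scalemx1.
by rewrite !det_mulmx mulrAC -det_mulmx PP det1 mul1r.
Qed.

(** The spectral theorem gives the eigenvalues in an order of its own. The two factorizations of the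
    characteristic polynomial agree up to a permutation, and permuting the rows of the unitary
    matrix restores the order of [mu]. *)
Lemma hermitian_diagonalization n (A : 'M[R[i]]_n) (mu : 'I_n -> R) :
  A^t* = A -> char_poly A = \prod_i ('X - ((mu i)%:C%C)%:P) ->
  exists2 V : 'M[R[i]]_n, V \is unitarymx &
    V *m A *m V^t* = diag_mx (\row_i (mu i)%:C%C).
Proof.
move=> hA cA.
have nA : A \is normalmx by apply/normalmxP; rewrite hA.
set P := spectralmx A; set d := spectral_diag A.
have /orthomx_spectralP := nA; rewrite -/P -/d => eA.
have uP : P \is unitarymx by exact: spectral_unitarymx.
have PA : P *m A *m P^t* = diag_mx d.
  rewrite {1}eA !mulmxA mulmxV ?unitarymx_unit // mul1mx.
  by rewrite -mulmxA (unitarymxP uP) mulmx1.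
have cd : char_poly A = \prod_i ('X - (d 0 i)%:P).
  rewrite {1}eA char_poly_conj ?unitarymx_unit // char_poly_trig ?diag_mx_is_trig //.
  by apply: eq_bigr => i _; rewrite mxE eqxx.
pose td := [tuple d 0 i | i < n]; pose tmu := [tuple (mu i)%:C%C | i < n].
have : perm_eq tmu td.
  by apply: prod_XsubC_eq; rewrite !big_map -!enumT !big_enum -cA cd.
move=> /tuple_permP[p tp].
have mup i : (mu i)%:C%C = d 0 (p i).
  have : tnth tmu i = tnth [tuple tnth td (p i) | i < n] i.
    by congr (tnth _ i); apply: val_inj.
  by rewrite !tnth_map !tnth_ord_tuple.
exists (row_perm p P).
  have rowp i : row i (row_perm p P) = row (p i) P by apply/rowP => k; rewrite !mxE.
  apply/row_unitarymxP => i j; rewrite !rowp.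
  by rewrite (row_unitarymxP uP) (inj_eq perm_inj).
have -> : (row_perm p P)^t* = col_perm p (P^t*) by apply/matrixP => i j; rewrite !mxE.
rewrite row_permE col_permE -!mulmxA [A *m _]mulmxA [P *m _]mulmxA [P *m _]mulmxA PA.
rewrite mulmxA -row_permE -col_permE; apply/matrixP => i j; rewrite !mxE.
by rewrite (inj_eq perm_inj) mup.
Qed.

Lemma linear_row_sum (E : hilbertSpace R) n (T : 'rV[R[i]]_n -> E) a : linear T ->
  T a = \sum_i a 0 i *: T (delta_mx 0 i).
Proof.
move=> lT; have T0 : T 0 = 0.
  have := lT (-1) 0 0; rewrite scaler0 addr0 scaleN1r addNr //.
have TS (I : finType) (c : I -> R[i]) (v : I -> 'rV[R[i]]_n) (s : seq I) :
    T (\sum_(i <- s) c i *: v i) = \sum_(i <- s) c i *: T (v i).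
  by elim: s => [|i s IH]; rewrite ?big_nil ?big_cons // lT IH.
by rewrite {1}(row_sum_delta a) TS.
Qed.

(** The rows of [V] are the coordinates of the Ritz vectors. As coordinates are row vectors, the
    matrix diagonalized is the transpose of [gram T]. *)
Lemma gram_diagonalization (E : hilbertSpace R) n (T : 'rV[R[i]]_n -> E)
    (mu : 'I_n -> R) :
  linear T -> eigenvalues_of (gram T) mu ->
  exists2 V : 'M[R[i]]_n, V \is unitarymx &
    forall i j, inner E (T (row i V)) (T (row j V)) = (i == j)%:R * (mu i)%:C%C.
Proof.
move=> lT [_ cp]; pose A := (gram T)^T.
have AE i j : A i j = inner E (T (delta_mx 0 i)) (T (delta_mx 0 j)) by rewrite !mxE.
have hA : A^t* = A by apply/matrixP => i j; rewrite mxE mxE !AE -innerC.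
have [|V uV eV] := hermitian_diagonalization hA (mu := mu).
  by rewrite char_poly_trmx.
exists V => // i j; have /matrixP/(_ i j) := eV; rewrite !mxE mulr_natl => <-.
rewrite [X in inner E _ X](linear_row_sum _ lT) inner_sumr; apply: eq_bigr => k _.
rewrite innerZr !mxE mulrC; congr (_ * _).
rewrite (linear_row_sum _ lT) inner_suml; apply: eq_bigr => l _.
by rewrite innerZl !mxE.
Qed.

End RitzVectors.

(** * Principal angles *)

Section Projections.
Context {R : realType} {E : hilbertSpace R}.
Implicit Types (W : set E) (x y z : E) (B : E -> E).

(** A relation, because [orthoproj] returns the default 0 where no projection exists, and existence
    for inv(H^(1/2)) ran X is known only once its dimension is. *)
Definition is_proj W x y := W y /\ forall w, W w -> inner E (x - y) w = 0.

Lemma is_proj_unique W x y z : subspace W -> is_proj W x y -> is_proj W x z -> y = z.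
Proof.
move=> sW [Wy hy] [Wz hz]; apply/eqP; rewrite -subr_eq0 -nsq_eq0.
have Wyz := subspaceB sW Wy Wz; apply/eqP/ipE.
have e : y - z = (x - z) - (x - y) by rewrite opprB [RHS]addrC addrA subrK.
by rewrite {1}e innerBl hz // hy // subr0.
Qed.

Lemma orthoproj_eq W x y : subspace W -> is_proj W x y -> orthoproj W x = y.
Proof.
by move=> sW xy; apply: xget_unique => // z xz; exact: (is_proj_unique sW xz xy).
Qed.

Lemma orthoproj_orth W x : subspace W -> (forall w, W w -> inner E x w = 0) ->
  orthoproj W x = 0.
Proof.
move=> sW xW; apply: orthoproj_eq => //.
by split=> [|w Ww]; rewrite ?subr0 ?xW //; exact: sW.1.
Qed.

Lemma orthoproj_id W x : subspace W -> W x -> orthoproj W x = x.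
Proof.
move=> sW Wx; apply: orthoproj_eq => //.
by split=> // w _; rewrite subrr inner0l.
Qed.

Lemma orthoprojN W x : ~ (exists y, is_proj W x y) -> orthoproj W x = 0.
Proof. by move=> nx; apply: xgetPN => y Wy; apply: nx; exists y. Qed.

(** If [x] has no projection, neither has its nonzero multiple, and both sides are the default 0.
    Operator norms can thus be handled before existence is known. *)
Lemma orthoprojZ W (r : R) x : subspace W -> r != 0 ->
  orthoproj W (r%:C%C *: x) = r%:C%C *: orthoproj W x.
Proof.
move=> sW r0.
have scale (s : R) u y : is_proj W u y -> is_proj W (s%:C%C *: u) (s%:C%C *: y).
  move=> [Wy hy]; split=> [|w Ww]; first exact: subspaceZ.
  by rewrite -scalerBr innerZl hy // mulr0.
have [[y xy]|nx] := pselect (exists y, is_proj W x y).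
  by rewrite (orthoproj_eq sW xy); apply: orthoproj_eq => //; apply: scale.
rewrite (orthoprojN nx) scaler0; apply: orthoprojN => -[y /(scale r^-1) xy].
apply: nx; exists (r^-1%:C%C *: y); move: xy.
by rewrite scalerA -rmorphM mulVf // scale1r.
Qed.

Lemma orthoproj_contraction W x : subspace W ->
  nsq (orthoproj W x) <= nsq x /\ nsq (x - orthoproj W x) <= nsq x.
Proof.
move=> sW; have [[y xy]|nx] := pselect (exists y, is_proj W x y); last first.
  by rewrite orthoprojN // subr0 nsq0 nsq_ge0.
rewrite (orthoproj_eq sW xy); have [Wy hy] := xy.
have -> : nsq x = nsq (x - y) + nsq y by rewrite -(nsqD_orth (hy _ Wy)) subrK.
by rewrite lerDl lerDr !nsq_ge0.
Qed.

Lemma sqr_norm x : complex.Re `|x| ^+ 2 = nsq x.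
Proof.
apply: (@complexI R); rewrite nsq_norm -[in RHS](RRe_real (normr_real x)).
by rewrite rmorphXn.
Qed.

Lemma Re_norm_ge0 x : 0 <= complex.Re `|x|.
Proof. by rewrite -ler0c RRe_real ?normr_real. Qed.

Lemma norm_le1 x : (`|x| <= 1) = (nsq x <= 1).
Proof.
rewrite -(@expr_le1 _ 2) // -nsq_norm -(rmorph1 (real_complex R)) lecR //.
Qed.

(** The contraction property makes the supremum finite; homogeneity under real scalars carries its
    bound from the unit ball to every vector. *)
Lemma opnormP B : (forall x, nsq (B x) <= nsq x) ->
  (forall (r : R) x, r != 0 -> B (r%:C%C *: x) = r%:C%C *: B x) ->
  0 <= opnorm B <= 1 /\ forall x, nsq (B x) <= opnorm B ^+ 2 * nsq x.
Proof.
move=> B1 BZ; rewrite /opnorm; set A := image _ _.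
have ubA : ubound A 1.
  move=> _ [x /= x1 <-]; rewrite -(@expr_le1 _ 2) ?Re_norm_ge0 // sqr_norm.
  by apply: le_trans (B1 x) _; rewrite -norm_le1.
have A0 : A (complex.Re `|B 0|) by exists 0 => //=; rewrite normr0 ler01.
have le_sup b : A b -> b <= sup A by apply: ub_le_sup; exists 1.
have sup0 : 0 <= sup A := le_trans (Re_norm_ge0 _) (le_sup _ A0).
split.
  by rewrite sup0 /=; apply: ge_sup => //; exists (complex.Re `|B 0|).
move=> x; have [x0|x0] := eqVneq x 0.
  by apply: le_trans (B1 x) _; rewrite x0 nsq0 mulr0.
have nx : 0 < nsq x by rewrite nsq_gt0.
pose r := (Num.sqrt (nsq x))^-1.
have r2 : r ^+ 2 = (nsq x)^-1 by rewrite exprVn sqr_sqrtr // ltW.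
have r0 : r != 0 by rewrite invr_eq0 gt_eqF // sqrtr_gt0.
have : complex.Re `|B (r%:C%C *: x)| <= sup A.
  apply: le_sup; exists (r%:C%C *: x) => //=.
  by rewrite norm_le1 nsqZ r2 mulVf // gt_eqF.
rewrite -(ler_pXn2r (n := 2)) ?nnegrE ?Re_norm_ge0 // sqr_norm BZ // nsqZ r2.
by rewrite ler_pdivrMl // mulrC.
Qed.

Lemma young_le (s : R) x y z : 0 <= s -> nsq y <= s ^+ 2 * nsq z ->
  2 * ip x y <= s * (nsq x + nsq z).
Proof.
rewrite le_eqVlt => /predU1P[<-|s0] h.
  have /eqP : nsq y = 0.
    by apply/eqP; rewrite eq_le nsq_ge0 andbT; move: h; rewrite expr0n mul0r.
  by rewrite nsq_eq0 => /eqP ->; rewrite ip0r mulr0 mul0r.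
apply: le_trans (young x y s0) _; rewrite mulrDr lerD2l ler_pdivrMr //.
by apply: le_trans h _; rewrite expr2 [leRHS]mulrAC.
Qed.

End Projections.

Lemma linear_range_has_dim (R : realType) (E : hilbertSpace R) m
    (T : 'rV[R[i]]_m -> E) :
  linear T -> (forall a, T a = 0 -> a = 0) -> has_dim (range T) m.
Proof.
move=> lT injT.
pose T' : {linear 'rV[R[i]]_m -> E} := HB.pack T (GRing.isLinear.Build _ _ _ _ T lT).
exists T'; split=> // a b ab; apply/eqP; rewrite -subr_eq0; apply/eqP/injT.
by rewrite -[T _]/(T' _) linearB ab subrr.
Qed.

Lemma range_subspace (R : realType) (E : hilbertSpace R) m (T : 'rV[R[i]]_m -> E) :
  linear T -> subspace (range T).
Proof.
move=> lT; split; last first.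
  by move=> a _ _ [b _ <-] [c _ <-]; exists (a *: b + c); rewrite // lT.
by exists 0 => //; have := lT (-1) 0 0; rewrite scaler0 addr0 scaleN1r addNr.
Qed.

Lemma adj_dotmx (R : realType) (E : hilbertSpace R) m (T : 'rV[R[i]]_m -> E) y a :
  linear T -> dotmx (adj T y) a = inner E y (T a).
Proof.
move=> lT.
pose T' : {linear 'rV[R[i]]_m -> E} := HB.pack T (GRing.isLinear.Build _ _ _ _ T lT).
exact: (adjE T').
Qed.

Section PrincipalAngle.
Context {R : realType} {E : hilbertSpace R}.
Variables (H S : operator E) (n : nat) (X : {linear 'rV[R[i]]_n -> E}).
Hypothesis saH : selfadjoint H.
Hypothesis sqrtS : is_sqrt S H.
Hypothesis lam_e0 : (0 < lambda_e H)%E.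
Hypothesis isoX : isometry (inner E) (@dotmx R[i] n) X.
Hypothesis domX : range X `<=` opdom S.
Hypothesis injSX : forall a, S (X a) = 0 -> a = 0.

Let saS : selfadjoint S. Proof. by case: sqrtS. Qed.
Let linS : linear_operator S. Proof. by case: saS. Qed.
Let SX a : opdom S (X a). Proof. by apply: domX; exists a. Qed.

Local Notation W1 := (S @` range X).
Local Notation W2 := (opinv S (range X)).
Local Notation P1 := (orthoproj W1).
Local Notation P2 := (orthoproj W2).
Local Notation s := (sin (principal_angle W1 W2)).

Lemma linear_SX : linear (fun a => S (X a)).
Proof. by move=> a x y; rewrite linearP linS.2. Qed.

Lemma W1E : W1 = range (fun a => S (X a)).
Proof. by rewrite image_comp. Qed.

Lemma dimW1 : has_dim W1 n.
Proof. by rewrite W1E; apply: linear_range_has_dim linear_SX injSX. Qed.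

Let subW1 : subspace W1.
Proof. by rewrite W1E; apply: range_subspace; exact: linear_SX. Qed.

Let subW2 : subspace W2.
Proof.
split.
  by split; [exact: linS.1.1|exists 0; rewrite // linear0 operator0].
move=> a x y [Sx [b _ bx]] [Sy [c _ cy]]; split; first exact: linS.1.2.
by exists (a *: b + c); rewrite // linS.2 // linearP bx cy.
Qed.

Lemma proj_compl_contraction (W W' : set E) : subspace W -> subspace W' ->
  let B x := orthoproj W (x - orthoproj W' x) in
  0 <= opnorm B <= 1 /\ forall x, nsq (B x) <= opnorm B ^+ 2 * nsq x.
Proof.
move=> sW sW' B; apply: opnormP => [x|r x r0].
  apply: le_trans (orthoproj_contraction _ sW).1 _.
  exact: (orthoproj_contraction _ sW').2.
by rewrite /B orthoprojZ // -scalerBr orthoprojZ.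
Qed.

(** Both norms lie in [0, 1], so the sine undoes [asin]. Which of them is the minimum is left
    open. *)
Lemma sin_principal_angle : 0 <= s <= 1 /\
  (s = opnorm (fun x => P1 (x - P2 x)) \/ s = opnorm (fun x => P2 (x - P1 x))).
Proof.
have [/andP[a0 a1] _] := proj_compl_contraction subW1 subW2.
have [/andP[b0 b1] _] := proj_compl_contraction subW2 subW1.
rewrite /principal_angle asinK; last first.
  rewrite in_itv /= le_min ge_min a1 /= andbT.
  by rewrite !(le_trans (lerN10 R)).
by rewrite minElt; case: ifP => _; rewrite ?a0 ?a1 ?b0 ?b1; split=> //; [left|right].
Qed.

Lemma orthogonal_SW2 v y : opdom S v -> (forall b, inner E v (X b) = 0) -> W2 y ->
  inner E (S v) y = 0.
Proof.
by move=> Sv vX [Sy [b _ bS]]; rewrite (selfadjointP saS) // -bS vX.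
Qed.

(** A null vector of [S] lies in [W2], since 0 is in ran X, and is orthogonal to [W1] by symmetry.
    So P2 (1 - P1) fixes it, and its norm is below 1. *)
Lemma kernel_trivial : s < 1 -> s = opnorm (fun x => P2 (x - P1 x)) ->
  forall x, opdom S x -> S x = 0 -> x = 0.
Proof.
move=> s1 e x Sx x0; have [_ /(_ x)] := proj_compl_contraction subW2 subW1.
rewrite -e.
have xW1 w : W1 w -> inner E x w = 0.
  by rewrite W1E => -[a _ <-]; rewrite -(selfadjointP saS) // x0 inner0l.
rewrite (orthoproj_orth subW1 xW1) subr0 orthoproj_id //; last first.
  by split=> //; exists 0; rewrite // linear0.
move=> h; apply/eqP; rewrite -nsq_eq0 eq_le nsq_ge0 andbT leNgt; apply/negP => nx.
have [/andP[s0 _] _] := sin_principal_angle.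
by move: h; rewrite ler_pMl // leNgt expr_lt1 // s1.
Qed.

(** 0 lies below [lambda_e H], so it is in the resolvent set unless it is an eigenvalue; and a null
    vector of [H] is one of [S]. *)
Lemma resolvent_at_0 : (forall x, opdom S x -> S x = 0 -> x = 0) ->
  exists2 B : E -> E, linear B & forall y, opdom H (B y) /\ H (B y) = y.
Proof.
move=> kS; have linH : linear_operator H by case: saH.
have [B [B1 B2 _]] : resolvent_set H 0%:C%C.
  apply: below_lambda_e => // -[_ _ [m [m0 dm]]].
  have [x [Hx ex] /eqP] := has_dim_nonzero dm m0; apply; apply: kS.
    exact: (opdom_sqrt sqrtS).
  apply/eqP; rewrite -nsq_eq0; apply/eqP/ipE.
  by rewrite -(form_sqrt sqrtS) ?ex ?scale0r ?inner0l //; exact: (opdom_sqrt sqrtS).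
have B1' y : opdom H (B y) /\ H (B y) = y.
  by have [h] := B1 y; rewrite scale0r subr0.
exists B => // a x y; have [hx ex] := B1' x; have [hy ey] := B1' y.
rewrite -[RHS]B2; last exact: linH.1.2.
by rewrite linH.2 // ex ey scale0r subr0.
Qed.

Lemma angle_inequality a v : s < 1 -> range X a -> opdom S v ->
  (forall b, inner E v (X b) = 0) ->
  2 * ip (S a) (S v) <= s * (nsq (S a) + nsq (S v)).
Proof.
move=> s1 [c _ <-{a}] Sv vX.
have [/andP[s0 _] [e|e]] := sin_principal_angle.
  (* Here [s] is the norm of P1 (1 - P2). As [S v] is orthogonal to [W2], |P1 S v| <= s |S v|, and
     only P1 S v pairs with elements of [W1]. *)
  have [_ /(_ (S v))] := proj_compl_contraction subW1 subW2.
  rewrite -e (orthoproj_orth subW2 (fun y => @orthogonal_SW2 v y Sv vX)) subr0 => h.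
  have [y W1y yP] := has_dim_projection (S v) dimW1.
  rewrite (orthoproj_eq subW1 (conj W1y yP)) in h.
  apply: le_trans (young_le (S (X c)) s0 h).
  have /yP/ipE : W1 (S (X c)) by exists (X c) => //; exists c.
  by rewrite ipDl ipNl ipC (ipC y) => /eqP; rewrite subr_eq0 => /eqP ->.
(* Here [s] is the norm of P2 (1 - P1). Injectivity of [S] makes [W2] the n-dimensional range of S
   H^-1 X. *)
have kS := kernel_trivial s1 e.
have [B linB BP] := resolvent_at_0 kS.
have linSB : linear (fun b => S (B (X b))).
  move=> r x y; rewrite linearP linB linS.2 //; apply: (opdom_sqrt sqrtS).
  - exact: (BP _).1.
  - exact: (BP _).1.
have HSB b : opdom S (S (B (X b))) /\ S (S (B (X b))) = X b.
  have [hB eB] := BP (X b); case: sqrtS => _ _ [domH HE].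
  by have := hB; rewrite domH => -[_ ?]; split=> //; rewrite -HE.
have W2E : W2 = range (fun b => S (B (X b))).
  apply/seteqP; split=> [y [Sy [b _ bS]]|_ [b _ <-]].
    exists b => //; apply/eqP; rewrite -subr_eq0; apply/eqP/kS.
      by apply: subspaceB => //; [exact: linS.1|exact: (HSB b).1].
    by rewrite (operatorB linS (HSB b).1 Sy) (HSB b).2 bS subrr.
  by split; [exact: (HSB b).1|exists b; rewrite ?(HSB b).2].
have injX b : X b = 0 -> b = 0.
  by move=> Xb; apply: injSX; rewrite Xb operator0.
have dimW2 : has_dim W2 n.
  rewrite W2E; apply: linear_range_has_dim linSB _ => b eb.
  by apply: injX; rewrite -(HSB b).2 eb operator0.
(* [y] is an element of [W2] whose projection onto [W1] is [x]: S y = X b with b = (S X)^* x, hence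
   (y, S X d) = (x, S X d). *)
pose b := adj (fun a => S (X a)) (S (X c)); pose y := S (B (X b)).
pose x := S (X c).
have W2y : W2 y by rewrite W2E; exists b.
have yx w : W1 w -> inner E (y - x) w = 0.
  rewrite W1E => -[d _ <-]; rewrite innerBl -(selfadjointP saS (HSB b).1 (SX d)).
  by rewrite (HSB b).2 isoX /= /b (adj_dotmx _ _ linear_SX) subrr.
have W1x : W1 x by exists (X c) => //; exists c.
pose w := y - x; have wx : inner E w x = 0 by exact: yx.
have [p W2p pw] := has_dim_projection w dimW2.
have [_ /(_ w)] := proj_compl_contraction subW2 subW1.
rewrite -e (orthoproj_orth subW1 yx) subr0 (orthoproj_eq subW2 (conj W2p pw)) => hp.
have nw : nsq w = ip p y.
  have /ipE := pw _ W2y; rewrite ipDl ipNl => /eqP; rewrite subr_eq0 => /eqP <-.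
  by rewrite -[X in ip w X](subrK x) ipDr (ipE wx) addr0.
have ny : nsq y = nsq x + nsq w by rewrite addrC -(nsqD_orth wx) subrK.
(* [w] is orthogonal to [W1], so |w|^2 = (P2 w, y) with |P2 w| <= s |w|, whence |w| <= s |y|. *)
have hw : nsq w <= s ^+ 2 * nsq y.
  have [s00|s_neq0] := eqVneq s 0.
    have /eqP : nsq p = 0.
      by apply/eqP; rewrite eq_le nsq_ge0 andbT; move: hp; rewrite s00 expr0n mul0r.
    by rewrite nsq_eq0 nw => /eqP ->; rewrite ip0l mulr_ge0 ?sqr_ge0 ?nsq_ge0.
  have s2 : 0 < s ^+ 2 by rewrite exprn_even_gt0.
  have := young p y (_ : 0 < s ^- 2); rewrite invr_gt0 invrK -nw => /(_ s2).
  have : s ^- 2 * nsq p <= nsq w by rewrite ler_pdivrMl.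
  rewrite [nsq y * _]mulrC; lra.
have xy : ip x y = nsq x.
  by rewrite -(subrK x y) ipDr (ipC x) (ipE wx) add0r.
have zy : ip (S v) y = 0 by apply/ipE/orthogonal_SW2.
have [y0|y0] := eqVneq (nsq y) 0.
  have -> : S (X c) = 0.
    apply/eqP; rewrite -nsq_eq0 -/x eq_le nsq_ge0 andbT -y0 ny.
    by rewrite lerDl nsq_ge0.
  by rewrite ip0l mulr0 nsq0 add0r mulr_ge0 // nsq_ge0.
have ny0 : 0 < nsq y by rewrite lt_def y0 nsq_ge0.
(* r y is the projection of [x] onto the line of [y]. It can be subtracted because [S v] is
   orthogonal to [y], and the rest has norm at most s |x|. *)
pose r := nsq x / nsq y.
have hxy : nsq (x - r%:C%C *: y) <= s ^+ 2 * nsq x.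
  rewrite nsqD nsqN nsqZ !ip_simp xy.
  have -> : nsq x + r ^+ 2 * nsq y + 2 * - (r * nsq x) = nsq x * (nsq w / nsq y).
    have -> : nsq w = nsq y - nsq x by rewrite ny; ring.
    by rewrite /r; field.
  by rewrite mulrC ler_wpM2r ?nsq_ge0 // ler_pdivrMr.
have := young_le (S v) s0 hxy; rewrite ipDr ipNr ipZr zy mulr0 subr0.
by rewrite (ipC (S v)) [nsq (S v) + _]addrC.
Qed.

End PrincipalAngle.

(** * Relative gaps and the block diagonal part *)

Section RelativeGap.
Context {R : realType}.
Implicit Types (s l m : R).

(** Clearing denominators leaves l < (1 - 2 s) m. An infinite [l] would make the right side -1, and
    l + m = 0 would make it 0 by the convention on inverses; both contradict the strict
    inequality. *)
Lemma rel_gap_below s (l : \bar R) m : 0 <= s < 1 -> (0 <= l)%E -> 0 <= m ->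
  s / (1 - s) < - rel_gap l m ->
  exists l', [/\ l = l'%:E, 0 <= l' < (1 - s) * m & 0 < m].
Proof.
move=> /andP[s0 s1]; have t0 : 0 < 1 - s by rewrite subr_gt0.
have eta0 : 0 <= s / (1 - s) by rewrite divr_ge0 // ltW.
case: l => [l| |//]; last first.
  by move=> _ _ /= /(le_lt_trans eta0); rewrite oppr_gt0 ltr10.
rewrite lee_fin => l0 m0 /=; rewrite -mulNr opprB => h.
have lm : 0 < l + m.
  rewrite lt_def addr_ge0 // andbT; apply: contraTneq h => ->.
  by rewrite invr0 mulr0 -leNgt.
move: h; rewrite ltr_pdivlMr // mulrAC ltr_pdivrMr // => h.
have sl := mulr_ge0 s0 l0; have sm := mulr_ge0 s0 m0.
by exists l; split=> //; rewrite ?l0 /=; lra.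
Qed.

(** Clearing denominators leaves m < (1 - 2 s) l, and (1 + s) (1 - 2 s) <= 1. *)
Lemma rel_gap_above s (l : \bar R) m : 0 <= s < 1 -> (0 <= l)%E -> 0 <= m ->
  s / (1 - s) < rel_gap l m -> (((1 + s) * m)%:E < l)%E.
Proof.
move=> /andP[s0 s1]; have t0 : 0 < 1 - s by rewrite subr_gt0.
have eta0 : 0 <= s / (1 - s) by rewrite divr_ge0 // ltW.
case: l => [l| |//]; last by rewrite ltry.
rewrite lee_fin lte_fin => l0 m0 /= h.
have lm : 0 < l + m.
  rewrite lt_def addr_ge0 // andbT; apply: contraTneq h => ->.
  by rewrite invr0 mulr0 -leNgt.
move: h; rewrite ltr_pdivlMr // mulrAC ltr_pdivrMr // => h.
have sl := mulr_ge0 s0 l0; have sm := mulr_ge0 s0 m0.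
have : (1 + s) * m < (1 + s) * ((1 - 2 * s) * l) by rewrite ltr_pM2l; lra.
have := mulr_ge0 s0 sl; lra.
Qed.

Lemma gamma_c_below n (lam : nat -> \bar R) (mu : 'I_n -> R) q (eta : R) k p :
  (eta%:E < gamma_c lam mu q)%E -> (1 <= p <= q - 1)%N -> eta < - rel_gap (lam p) (mu k).
Proof.
rewrite /gamma_c lt_min => /andP[h _] pq; rewrite -lte_fin.
by apply: lt_le_trans h _; apply: ereal_inf_lbound; exists k, p.
Qed.

Lemma gamma_c_above n (lam : nat -> \bar R) (mu : 'I_n -> R) q (eta : R) k p :
  (eta%:E < gamma_c lam mu q)%E -> (q + n <= p)%N -> eta < rel_gap (lam p) (mu k).
Proof.
rewrite /gamma_c !lt_min => /and3P[_ h _] pq; rewrite -lte_fin.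
by apply: lt_le_trans h _; apply: ereal_inf_lbound; exists k, p.
Qed.

End RelativeGap.

Section BlockDiagonal.
Context {R : realType} {E : hilbertSpace R}.
Variables (h : hilbert_form E) (H S H' S' : operator E) (n : nat).
Variables (X : {linear 'rV[R[i]]_n -> E}) (u : 'I_n -> E) (mu : 'I_n -> R).
Hypothesis assocH : associated_operator h H S.
Hypothesis isoX : isometry (inner E) (@dotmx R[i] n) X.
Hypothesis domX : range X `<=` fdom h.
Hypothesis ou : orthonormal_family u.
Hypothesis Xu : forall i, range X (u i).
Hypothesis ritz : forall i j, inner E (S (u i)) (S (u j)) = (i == j)%:R * (mu i)%:C%C.

Let P v := X (adj X v).

Lemma isometry_injective a : X a = 0 -> a = 0.
Proof.
move=> Xa; have e : inner E (X a) (X a) = dotmx a a := isoX a a.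
by apply/eqP; rewrite -(dnorm_eq0 (@dotmx R[i] n)) /= -e Xa inner0l.
Qed.

Lemma range_ritz x : range X x -> x = ritz_proj u x.
Proof.
have linX : linear X by move=> a b c; rewrite linearP.
move=> Wx; have sW := range_subspace linX; apply/eqP; rewrite -subr_eq0; apply/eqP.
have dX : has_dim (range X) n.
  exact: linear_range_has_dim linX isometry_injective.
apply: (orthonormal_complete dX Xu ou) => [|i]; last exact: ritz_proj_orth.
by apply: subspaceB => //; apply: subspace_sum => // i _; apply: subspaceZ.
Qed.

Lemma ritz_orth_range v b : (forall i, inner E v (u i) = 0) -> inner E v (X b) = 0.
Proof.
move=> vu; rewrite (range_ritz (ex_intro2 _ _ b I erefl)) inner_sumr big1 // => i _.
by rewrite innerZr vu mulr0.
Qed.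

Lemma proj_ritz v : P v = ritz_proj u v.
Proof.
rewrite /P (range_ritz (ex_intro2 _ _ (adj X v) I erefl)); apply: eq_bigr => i _.
by have [b _ <-] := Xu i; rewrite isoX /= adjE.
Qed.

(** h'(u_i, v) = h(u_i, P v) = mu_i (u_i, v), as the Ritz vectors diagonalize [h] on ran X.
    Selfadjointness of [S'] then puts S' u_i in the domain of [S']. *)
Lemma block_diagonal_eigenvector i : associated_operator (block_diagonal h P) H' S' ->
  opdom H' (u i) /\ H' (u i) = (mu i)%:C%C *: u i.
Proof.
move=> [_ _ [saS' _ [domH' HE']] domS' hE'].
have [_ _ [[linS _ _] _ _] domS hE] := assocH.
have uD : fdom h (u i) by exact: domX.
have Su j : opdom S (u j) by rewrite domS; exact: domX.
have PuD v : fdom h (P v) by apply: domX; exists (adj X v).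
have Pu : P (u i) = u i by rewrite proj_ritz -range_ritz.
have blockE v : fdom h v -> inner E (S' (u i)) (S' v) = inner E ((mu i)%:C%C *: u i) v.
  move=> vD; rewrite -hE' //= Pu subrr hE // hE //; last 2 first.
  - by rewrite -domS; exact: linS.1.1.
  - by rewrite -domS; apply: subspaceB; [exact: linS.1|rewrite domS|rewrite domS].
  rewrite (operator0 linS) inner0l addr0 proj_ritz.
  have [_ ->] := S_sum linS Su (index_enum _) (fun j => inner E v (u j)) id.
  rewrite inner_sumr (bigD1 i) //= big1 => [|j ji].
    by rewrite addr0 innerZr ritz eqxx mul1r innerZl -innerC mulrC.
  by rewrite innerZr ritz eq_sym (negPf ji) mul0r mulr0.
have Su' : opdom S' (u i) by rewrite domS'.
have [_ _ sa] := saS'.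
have [SSu SSE] : opdom S' (S' (u i)) /\ S' (S' (u i)) = (mu i)%:C%C *: u i.
  apply/(sa (S' (u i))) => x; rewrite domS' => xD.
  by rewrite innerC blockE // -innerC.
have Hu : opdom H' (u i) by rewrite domH'.
by rewrite HE'.
Qed.

Lemma range_proj_block_diagonal : (forall i, 0 < mu i) ->
  associated_operator (block_diagonal h P) H' S' -> range P `<=` oprange H'.
Proof.
move=> mu0 assoc' _ [v _ <-]; have [[linH' _ _] _ _ _ _] := assoc'.
have dom i c : opdom H' (c *: u i).
  by apply: subspaceZ; [exact: linH'.1|exact: (block_diagonal_eigenvector i assoc').1].
exists (\sum_i (inner E v (u i) / (mu i)%:C%C) *: u i).
  by apply: subspace_sum => //; exact: linH'.1.
rewrite (operator_sum linH') // proj_ritz; apply: eq_bigr => i _.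
have [hu eu] := block_diagonal_eigenvector i assoc'.
rewrite operatorZ // eu scalerA mulfVK //.
by rewrite fmorph_eq0 gt_eqF.
Qed.

End BlockDiagonal.

(** * The range inclusion and the eigenvalue bounds *)

Theorem theorem5p2 (R : realType) (E : hilbertSpace R) (h : hilbert_form E)
    (H Hhalf : operator E) (n : nat) (X : {linear 'rV[R[i]]_n -> E})
    (H' Hhalf' : operator E) (mu : 'I_n -> R) (lam : nat -> \bar R) (q : nat) :
  let P := fun u : E => X (adj X u) in
  let Xi := gram (fun a => Hhalf (X a)) in
  let sinTheta := sin (principal_angle (Hhalf @` range X) (opinv Hhalf (range X))) in
  let eta := sinTheta / (1 - sinTheta) in
  nonneg_form h ->
  associated_operator h H Hhalf ->
  (0 < lambda_e H)%E ->
  isometry (inner E) (@dotmx R[i] n) X ->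
  range X `<=` fdom h ->
  associated_operator (block_diagonal h P) H' Hhalf' ->
  eigenvalues_of Xi mu ->
  discrete_eigenvalues H lam ->
  (2 <= q)%N ->
  sinTheta < 1 ->
  (eta%:E < gamma_c lam mu q)%E ->
  range P `<=` oprange H' /\
  forall i : 'I_n,
    (* lam is counted from 1 and mu from 0 *)
    (lam (i + q)%N < lambda_e H)%E /\
    (`|lam (i + q)%N - (mu i)%:E| <= (mu i * sinTheta)%:E)%E.
Proof.
move=> P Xi s eta _ assocH lam_e0 isoX domX assocH' eigs lamH q2 s1 gap.
have [saH _ sqrtS domS hE] := assocH.
have linS : linear_operator Hhalf by case: sqrtS => -[].
have domSX : range X `<=` opdom Hhalf by rewrite domS.
have linSX := linear_SX sqrtS domSX.
have [V uV ritzV] := gram_diagonalization linSX eigs.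
have [mu_mono _] := eigs.
pose u i := X (row i V).
have ou : orthonormal_family u.
  by move=> i j; rewrite /u isoX; exact: (row_unitarymxP uV i j).
have Xu i : range X (u i) by exists (row i V).
have Su i : opdom Hhalf (u i) by exact: domSX.
have ritz i j : inner E (Hhalf (u i)) (Hhalf (u j)) = (i == j)%:R * (mu i)%:C%C.
  exact: ritzV.
have mu_ge0 i : 0 <= mu i.
  rewrite -ler0c; have := ritz i i; rewrite eqxx mul1r innerxx => <-.
  by rewrite ler0c nsq_ge0.
have lam0 p : (0 < p)%N -> (0 <= lam p)%E by exact: (lam_ge0 sqrtS lamH lam_e0).
(* h[X a] is the sum of mu_i |c_i|^2 over the Ritz coefficients c_i of [X a]. *)
have injSX_of : (forall i, 0 < mu i) -> forall a, Hhalf (X a) = 0 -> a = 0.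
  move=> mu0 a Sa; apply: (isometry_injective isoX).
  rewrite (range_ritz isoX ou Xu (ex_intro2 _ _ a I erefl)).
  apply: big1 => i _; have := Sa.
  have XaE := range_ritz isoX ou Xu (ex_intro2 _ _ a I erefl).
  have [_ SE] := S_sum linS Su (index_enum _) (fun j => inner E (X a) (u j)) id.
  rewrite {1}XaE /ritz_proj SE => /(congr1 nsq).
  rewrite (nsq_diagonal_sum _ ritz) nsq0 => /eqP.
  rewrite psumr_eq0 => [/allP/(_ i (mem_index_enum i))|j _]; last first.
    by rewrite mulr_ge0 ?abssq_ge0.
  by rewrite mulf_eq0 abssq_eq0 (gt_eqF (mu0 i)) orbF => /eqP ->; rewrite scale0r.
have [/andP[s0 _] _] := sin_principal_angle sqrtS domSX.
have s01 : 0 <= s < 1 by rewrite s0.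
have below k p : (1 <= p <= q - 1)%N ->
    exists l, [/\ lam p = l%:E, 0 <= l < (1 - s) * mu k & 0 < mu k].
  move=> pq; apply: rel_gap_below => //; first by case/andP: pq => /lam0.
  exact: (gamma_c_below k gap pq).
have above k p : (q + n <= p)%N -> (((1 + s) * mu k)%:E < lam p)%E.
  move=> pq; apply: rel_gap_above => //; last exact: (gamma_c_above k gap pq).
  by apply: lam0; apply: leq_trans pq; rewrite addn_gt0 (ltnW q2).
(* q >= 2 makes q - 1 an admissible index; the gap there gives lam_(q-1) finite and every Ritz value
   positive. *)
have q1 : (0 < q - 1 <= q - 1)%N by rewrite subn_gt0 q2 leqnn.
have mu_gt0 i : 0 < mu i by have [l []] := below i _ q1.
split.
  exact: (range_proj_block_diagonal assocH isoX domX ou Xu ritz mu_gt0 assocH').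
have injSX := injSX_of mu_gt0.
have sW : subspace (range X) by apply: range_subspace => a b c; rewrite linearP.
have angle a v : range X a -> opdom Hhalf v -> (forall i, inner E v (u i) = 0) ->
    2 * ip (Hhalf a) (Hhalf v) <= s * (nsq (Hhalf a) + nsq (Hhalf v)).
  move=> Xa Sv vu; apply: (angle_inequality saH sqrtS lam_e0 isoX domSX injSX s1) => // b.
  exact: (ritz_orth_range isoX ou Xu b vu).
(* The [m - j] directions orthogonal to [ran X] and the [r + 1] first Ritz
   vectors give a trial space of dimension [m - j + r + 1]. *)
have trial (m : nat) (j r : 'I_n) (l : R) : (0 < m)%N -> lam m = l%:E ->
    (l%:E < lambda_e H)%E -> (j <= m)%N -> (j <= r)%N -> l < (1 - s) * mu j ->
    (lam (m - j + r).+1 <= ((1 + s) * mu r)%:E)%E.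
  move=> m0 lm le jm jr lj.
  have [e [oe Se eb]] := eigenvector_span saH sqrtS lamH m0 lm le.
  have l0 : 0 <= l by rewrite -lee_fin -lm lam0.
  have lb : 0 <= l < (1 - s) * mu j by rewrite l0.
  apply: (eigenvalue_le saH sqrtS lamH lam_e0) => // f.
  by have := trial_vector linS ou sW Xu Su ritz mu_mono s0 s1 angle f oe Se eb jm jr lb.
have [_ bnd _] := lamH.
have le_lam_e p : (0 < p)%N -> (lam p <= lambda_e H)%E by move=> /bnd/andP[].
move=> i; have n0 : (0 < n)%N by apply: leq_ltn_trans (ltn_ord i).
have qn0 : (0 < q + n)%N by rewrite addn_gt0 n0 orbT.
have upper : (lam (i + q)%N <= ((1 + s) * mu i)%:E)%E.
  have [l [lq /andP[l0 lmu] _]] := below (Ordinal n0) _ q1.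
  have -> : (i + q = (q - 1 - (Ordinal n0 : 'I_n) + i).+1)%N.
    by rewrite subn0 subn1 -addSn prednK ?(ltnW q2) // addnC.
  apply: (trial _ _ _ _ _ lq _ _ _ lmu) => //; first by case/andP: q1.
  (* l < (1 - s) mu_0 <= (1 + s) mu_0 < lam_(q+n) <= lambda_e(H). *)
  apply: lt_le_trans (le_lam_e _ qn0).
  apply: le_lt_trans (above (Ordinal n0) _ (leqnn _)).
  rewrite lee_fin (le_trans (ltW lmu)) // ler_wpM2r //; lra.
have lt_e : (lam (i + q)%N < lambda_e H)%E.
  apply: le_lt_trans upper _; apply: lt_le_trans (le_lam_e _ qn0).
  exact: above.
have iq0 : (0 < i + q)%N by rewrite addn_gt0 (ltnW q2) orbT.
split=> //; have lE := eigenvalue_fin lamH iq0 lt_e.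
move: upper; rewrite lE lee_fin => upper.
rewrite -EFinB abse_EFin lee_fin ler_distl.
apply/andP; split; last by lra.
rewrite leNgt; apply/negP => lower.
have nn : (n.-1 < n)%N by rewrite prednK.
have le : ((fine (lam (i + q)%N))%:E < lambda_e H)%E by rewrite -lE.
have lmu : fine (lam (i + q)%N) < (1 - s) * mu i by lra.
have inn : (i <= Ordinal nn)%N by rewrite -ltnS prednK.
(* The index reached is (i + q) - i + (n - 1) + 1 = q + n, where the upper gap applies. *)
have := trial _ i (Ordinal nn) _ iq0 lE le (leq_addr _ _) inn lmu.
by rewrite leNgt above // addKn -addnS prednK.
Qed.
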